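(* Consider the Kiefer–Wolfowitz algorithm defined below with $\alpha_t=a/(u+t)^\gamma$ ($a,u>0$, $\gamma\in[0,1]$) and a fixed $\nu>0$. Assume Conditions (D1), (D2) and (D3), and suppose $$\nu\le\sqrt{\kappa/(3c)},$$ where $c$ is the constant in (D3). Then there are positive constants $\hat J,\hat I,\hat K,\hat L$ such that the following hold. - For all $t\ge0$ and $z\ge0$: $$\mathbb P\Big(\min_{x\in\mathcal X^\star}\|x_{t+1}-x\|\ge z\Big)\le \hat J e^{-\hat I t^\gamma z}.$$ - For all $t\ge1$: $$\mathbb E\Big[\min_{x\in\mathcal X^\star}\|x_{t+1}-x\|\Big]\le\frac{\hat K}{t^\gamma} \qquad\text{and}\qquad \mathbb E\Big[l(x_{t+1})-\min_{\mathcal X}l\Big]\le\frac{\hat L}{t^\gamma}.$$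
   Context: $\mathcal X\subseteq\mathbb R^d$ is a nonempty closed bounded convex set, and $\Pi_{\mathcal X}$ is Euclidean projection onto $\mathcal X$. $\hat w$ is a random variable, and $l(x,w)$ is a real function defined for all $x\in\mathbb R^d$. Set $l(x):=\mathbb E[l(x,\hat w)]$, assume $\sup_{x\in\mathcal X}\operatorname{Var}(l(x,\hat w))<\infty$, and assume $l$ is Lipschitz continuous on $\mathcal X$ with gradient (or chosen subgradient) map $\nabla l$. Let $\mathcal X^\star=\arg\min_{\mathcal X}l$. $e_i$ denotes the $i$-th unit vector. For $\nu\in\mathbb R$ write $$\mathbf l(x\pm\nu,w):=\big(l(x\pm\nu e_i,w)\big)_{i=1}^d,\qquad \mathbf l(x\pm\nu):=\big(l(x\pm\nu e_i)\big)_{i=1}^d.$$ KW algorithm: $x_0\in\mathcal X$, and for $t\ge0$ $$c_t=\frac{\mathbf l(x_t+\nu,\hat w_t^+)-\mathbf l(x_t-\nu,\hat w_t^-)}{2\nu},\qquad y_{t+1}=x_t-\alpha_tc_t,\qquad x_{t+1}=\Pi_{\mathcal X}(y_{t+1}),$$ where $\hat w_t^\pm$ are i.i.d. copies of $\hat w$, independent of each other and of $\mathcal F_t$, and $\mathcal F_{t+1}$ is generated by $\mathcal F_t$ and $\hat w_t^\pm$. Condition (D1): there is $\kappa>0$ such that for every $x\in\mathcal X$ and every $x^\star\in\mathcal X^\star$ with $\|x-x^\star\|=\min_{z\in\mathcal X^\star}\|x-z\|$, $\nabla l(x)^\top(x-x^\star)\ge\kappa\|x-x^\star\|$. Condition (D2):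 there are $\lambda>0$ and $M<\infty$ such that $\mathbb E[e^{\lambda\|c_t\|}\mid\mathcal F_t]\le M$ almost surely for all $t$. Condition (D3): there is $c>0$ such that $$\Big\|\nabla l(x)-\frac{\mathbf l(x+\nu)-\mathbf l(x-\nu)}{2\nu}\Big\|\le c\nu^2\qquad\text{for all }x\in\mathcal X.$$ *)

(* Defs.v *)
From HB Require Import structures.
From mathcomp Require Import all_boot all_order all_algebra.
From mathcomp Require Import all_classical all_reals all_analysis.

Set Implicit Arguments.
Unset Strict Implicit.
Unset Printing Implicit Defensive.

Import Order.TTheory GRing.Theory Num.Theory.
Import numFieldNormedType.Exports.

Local Open Scope classical_set_scope.
Local Open Scope ring_scope.

Section KW.
Variable R : realType.

Definition inner (d : nat) (u v : 'rV[R]_d) : R := \sum_(i < d) u 0 i * v 0 i.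
Definition enorm (d : nat) (u : 'rV[R]_d) : R := Num.sqrt (\sum_(i < d) u 0 i ^+ 2).
Definition unitv (d : nat) (i : 'I_d) : 'rV[R]_d := delta_mx 0 i.

Definition is_proj (d : nat) (X : set 'rV[R]_d) (p : 'rV[R]_d -> 'rV[R]_d) : Prop :=
  forall y, X (p y) /\ forall z, X z -> enorm (y - p y) <= enorm (y - z).

Definition argmin_set (d : nat) (X : set 'rV[R]_d) (f : 'rV[R]_d -> R) : set 'rV[R]_d :=
  [set x | X x /\ forall y, X y -> f x <= f y].
Definition dist_to (d : nat) (S : set 'rV[R]_d) (x : 'rV[R]_d) : R :=
  inf [set enorm (x - z) | z in S].

Definition kw_c (d : nat) (W T : Type) (l : 'rV[R]_d -> W -> R) (nu : R)
    (wp wm : nat -> T -> W) (t : nat) (x : 'rV[R]_d) (om : T) : 'rV[R]_d :=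
  (2 * nu)^-1 *: \row_(i < d) (l (x + nu *: unitv i) (wp t om)
                                - l (x - nu *: unitv i) (wm t om)).

Fixpoint kw_iter (d : nat) (W T : Type) (l : 'rV[R]_d -> W -> R) (nu : R)
    (alpha : nat -> R) (proj : 'rV[R]_d -> 'rV[R]_d) (x0 : 'rV[R]_d)
    (wp wm : nat -> T -> W) (t : nat) (om : T) : 'rV[R]_d :=
  match t with
  | 0 => x0
  | t'.+1 =>
      let x := kw_iter l nu alpha proj x0 wp wm t' om in
      proj (x - alpha t' *: kw_c l nu wp wm t' x om)
  end.

Definition wfam (W T : Type) (wp wm : nat -> T -> W) (i : nat * bool) : T -> W :=
  if i.2 then wp i.1 else wm i.1.

Definition mutually_independent dT dW (T : measurableType dT) (W : measurableType dW)
    (P : probability T R) (I : eqType) (X : I -> T -> W) : Prop :=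
  forall (s : seq I) (B : I -> set W), uniq s -> (forall i, measurable (B i)) ->
    P (\big[setI/setT]_(i <- s) (X i @^-1` B i)) = (\prod_(i <- s) P (X i @^-1` B i))%E.

Definition kw_filtration dW (T : Type) (W : measurableType dW)
    (wp wm : nat -> T -> W) (t : nat) : set (set T) :=
  <<s [set A | exists (i : nat * bool) (B : set W),
          (i.1 < t)%N /\ measurable B /\ A = wfam wp wm i @^-1` B] >>.

(** E[Y | G] <= M almost surely, stated through the defining property of
    conditional expectation: E[Y 1_A] <= M P(A) for every A in G (Y >= 0). *)
Definition cond_exp_le dT (T : measurableType dT) (P : probability T R)
    (G : set (set T)) (Y : T -> R) (M : R) : Prop :=
  forall A, G A -> (\int[P]_(om in A) (Y om)%:E <= M%:E * P A)%E.

End KW.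
Arguments unitv {R d}.

(* Main.v *)
(** Let [D t] be the distance from [x_ t] to the set of minimisers.  Comparing
    [x_ t.+1] with a point [xs] of that set nearest to [x_ t], (D1) and (D3)
    give a conditional drift of [D] of at most [- kappa / 2 * alpha t] as soon
    as [D t] exceeds a fixed multiple of [alpha t], and by (D2) the increments
    of [D / alpha t] have exponential moments.  Hence, as long as
    [th * alpha t] stays below a fixed [eta],
      [E expR (th * D t.+1)
         <= (1 - kappa / 4 * th * alpha t) * E expR (th * D t) + N].
    To bound [E expR (eps * (u + t) ^ gamma * D t.+1)] uniformly in [t], this
    recursion is iterated, with the exponent frozen at its final value, over
    the window [t/q, t]: there [th * alpha i] is of order one, and since the
    step sizes dominate a multiple of the harmonic series, their sum over the
    window exceeds any prescribed constant once [q] is large; that kills the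
    initial factor [expR (th * diameter)].  Markov's inequality and
    [x <= expR x] conclude.

    The nearest point [xs] is never selected measurably: conditioning on the
    past is done by Fubini on (past sigma-algebra) x (fresh noise), so [xs] is
    only needed for one fixed [x_ t] at a time. *)
Require Import Defs.
From HB Require Import structures.
From mathcomp Require Import all_boot all_order all_algebra.
From mathcomp Require Import all_classical all_reals all_analysis.
From mathcomp Require Import measurable_realfun ring lra.
Import Order.TTheory GRing.Theory Num.Theory.
Import numFieldNormedType.Exports.
Local Open Scope classical_set_scope.
Local Open Scope ring_scope.
Set Implicit Arguments.
Unset Strict Implicit.
Unset Printing Implicit Defensive.

(** * Euclidean geometry *)

Section Geometry.
Variables (R : realType) (d : nat).
Implicit Types (u v w x y z : 'rV[R]_d) (a b : R).

Lemma innerC u v : inner u v = inner v u.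
Proof. by apply: eq_bigr => i _; rewrite mulrC. Qed.

Lemma innerDl u v w : inner (u + v) w = inner u w + inner v w.
Proof. by rewrite -big_split; apply: eq_bigr => i _; rewrite mxE mulrDl. Qed.

Lemma innerZl a u v : inner (a *: u) v = a * inner u v.
Proof. by rewrite mulr_sumr; apply: eq_bigr => i _; rewrite mxE mulrA. Qed.

Lemma innerBl u v w : inner (u - v) w = inner u w - inner v w.
Proof. by rewrite -scaleN1r innerDl innerZl mulN1r. Qed.

Lemma innerBr u v w : inner u (v - w) = inner u v - inner u w.
Proof. by rewrite !(innerC u) innerBl. Qed.

Lemma innerZr a u v : inner u (a *: v) = a * inner u v.
Proof. by rewrite !(innerC u) innerZl. Qed.

Lemma enorm_sqr u : enorm u ^+ 2 = inner u u.
Proof. by rewrite sqr_sqrtr ?sumr_ge0// => i _; rewrite sqr_ge0. Qed.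

Lemma enorm_ge0 u : 0 <= enorm u. Proof. exact: sqrtr_ge0. Qed.

Lemma enorm_sqrB u v :
  enorm (u - v) ^+ 2 = enorm u ^+ 2 - 2 * inner u v + enorm v ^+ 2.
Proof. by rewrite !enorm_sqr innerBl !innerBr (innerC v u); ring. Qed.

Lemma enormZ a u : enorm (a *: u) = `|a| * enorm u.
Proof.
apply/eqP; rewrite -(@eqrXn2 _ 2)// ?mulr_ge0 ?enorm_ge0//.
by rewrite exprMn !enorm_sqr innerZl innerZr real_normK ?num_real// mulrA expr2.
Qed.

Lemma enormN u : enorm (- u) = enorm u.
Proof. by rewrite -scaleN1r enormZ normrN1 mul1r. Qed.

Lemma enormBC u v : enorm (u - v) = enorm (v - u).
Proof. by rewrite -enormN opprB. Qed.

Lemma cauchy_schwarz u v : `|inner u v| <= enorm u * enorm v.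
Proof.
rewrite -(@ler_pXn2r _ 2)// ?nnegrE ?mulr_ge0 ?enorm_ge0//.
rewrite real_normK ?num_real// exprMn.
have [v0|v0] := eqVneq (enorm v) 0.
  suff -> : inner u v = 0 by rewrite v0; nra.
  apply: big1 => i _; have /eqP := enorm_sqr v; rewrite v0 expr0n/= eq_sym.
  rewrite psumr_eq0 => [/allP/(_ i)|j _]; last by rewrite -expr2 sqr_ge0.
  by rewrite mem_index_enum => /(_ isT); rewrite -expr2 sqrf_eq0 => /eqP ->; rewrite mulr0.
(* The component of [u] orthogonal to [v] has nonnegative squared norm; the case [v = 0] was split
   off because of the division. *)
have := sqr_ge0 (enorm (u - (inner u v / enorm v ^+ 2) *: v)).
rewrite enorm_sqrB innerZr enormZ exprMn real_normK ?num_real//.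
set b := enorm v in v0 *; set c := inner u v; set a := enorm u => h.
have : 0 <= a ^+ 2 - c ^+ 2 / b ^+ 2.
  by apply: le_trans h _; rewrite le_eqVlt; apply/orP; left; apply/eqP; field.
rewrite subr_ge0 ler_pdivrMr// lt_neqAle eq_sym sqrf_eq0 v0/=; exact: sqr_ge0.
Qed.

Lemma enormD u v : enorm (u + v) <= enorm u + enorm v.
Proof.
rewrite -(@ler_pXn2r _ 2)// ?nnegrE ?addr_ge0 ?enorm_ge0//.
have := enorm_sqrB u (- v); rewrite opprK enormN => ->.
have : inner u (- v) = - inner u v by rewrite -scaleN1r innerZr mulN1r.
move=> ->; have := cauchy_schwarz u v; rewrite ler_norml => /andP[_ h]; nra.
Qed.

Lemma enorm_triB u v w : enorm (u - w) <= enorm (u - v) + enorm (v - w).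
Proof. by apply: le_trans _ (enormD _ _); rewrite addrA subrK. Qed.

Lemma enorm0 : enorm (0 : 'rV[R]_d) = 0.
Proof. by rewrite -(scale0r 0) enormZ normr0 mul0r. Qed.

Lemma coord_le_enorm u i : `|u 0 i| <= enorm u.
Proof.
rewrite -(@ler_pXn2r _ 2)// ?nnegrE ?enorm_ge0// real_normK ?num_real//.
rewrite enorm_sqr /inner (bigD1 i)//= -expr2 lerDl sumr_ge0// => j _.
by rewrite -expr2 sqr_ge0.
Qed.

Lemma enorm_eq0 u : enorm u = 0 -> u = 0.
Proof.
move=> u0; apply/rowP => i; rewrite mxE; apply/eqP; rewrite -normr_le0 -u0.
exact: coord_le_enorm.
Qed.

(** The factor [d] in place of its square root is crude but harmless: the bound only compares the
    Euclidean norm with the sup norm and with coordinatewise approximation. *)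
Lemma enorm_le_bound u a : 0 <= a -> (forall i, `|u 0 i| <= a) ->
  enorm u <= d%:R * a.
Proof.
move=> a0 ua; rewrite -(@ler_pXn2r _ 2)// ?nnegrE ?mulr_ge0 ?enorm_ge0//.
rewrite enorm_sqr; apply: (@le_trans _ _ (\sum_(i < d) a ^+ 2)).
  by apply: ler_sum => i _; rewrite -expr2 -real_normK ?num_real// ler_pXn2r ?nnegrE.
rewrite sumr_const card_ord -[leLHS]mulr_natl [leRHS]exprMn.
suff : d%:R <= d%:R ^+ 2 :> R by have := sqr_ge0 a; nra.
by rewrite -natrX ler_nat; case: (d) => // n; rewrite expnS leq_pmulr// expn1.
Qed.

Lemma enorm_le_mx_norm u : enorm u <= d%:R * `|u|.
Proof.
apply: enorm_le_bound => // i.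
rewrite [leRHS](mx_normrE u); apply/bigmax_geP; right => /=.
by exists (0, i).
Qed.

Lemma lipschitz_continuous (f : 'rV[R]_d -> R) a :
  (forall x y, `|f x - f y| <= a * enorm (x - y)) -> continuous f.
Proof.
move=> fl x; apply/(cvgrPdist_le (FF := nbhs_filter x)) => e e0.
have k0 : 0 < `|a| * d%:R + 1 by rewrite ltr_wpDl ?mulr_ge0.
apply/(@nbhs_normP R 'rV[R]_d x); exists (e / (`|a| * d%:R + 1)) => /=; first exact: divr_gt0.
move=> y /=; rewrite ltr_pdivlMr// => /ltW; apply: le_trans.
apply: (le_trans (fl x y)); have := enorm_le_mx_norm (x - y).
have := enorm_ge0 (x - y); have := ler_norm a; have := normr_ge0 (x - y).
by have := normr_ge0 a; nra.
Qed.

(** * Euclidean projection onto a convex set *)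

Section Projection.
Variables (X : set 'rV[R]_d) (p : 'rV[R]_d -> 'rV[R]_d).
Hypotheses (cX : convex_set X) (pX : is_proj X p).

(** Obtuse angle criterion: if the inner product [s] were positive, a short move from [p y] towards
    [z] would stay in [X] and come strictly closer to [y]. *)
Lemma proj_variational y z : X z -> inner (y - p y) (z - p y) <= 0.
Proof.
move=> Xz; rewrite leNgt; apply/negP => s0.
set s := inner _ _ in s0; set n := enorm (z - p y) ^+ 2.
have n0 : 0 <= n by exact: sqr_ge0.
(* The squared distance changes by [t ^+ 2 * n - 2 * t * s], negative for this [t]; adding [s] in
   the denominator covers [n = 0] and gives [t <= 1]. *)
pose t := s / (s + n).
have sn0 : 0 < s + n by rewrite ltr_pwDl.
have t0 : 0 < t by rewrite divr_gt0.
have t1 : t <= 1 by rewrite ler_pdivrMr// mul1r lerDl.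
have Xt : X (p y + t *: (z - p y)).
  have /set_mem := @cX (z : convex_lmodType _) (p y) (Itv01 (ltW t0) t1)
    (mem_set Xz) (mem_set (pX y).1).
  rewrite /conv/=; congr (X _); apply/rowP => i; rewrite !mxE/= /unstable.onem; ring.
have := (pX y).2 _ Xt.
rewrite opprD addrA -(@ler_pXn2r _ 2)// ?nnegrE ?enorm_ge0// (enorm_sqrB (y - p y)).
rewrite innerZr enormZ exprMn real_normK ?num_real// -/s -/n => h.
have : t * (s + n) = s by rewrite /t mulfVK// gt_eqF.
nra.
Qed.

(** Adding the variational inequalities at [y] and at [z] gives [enorm (p y - p z) ^+ 2 <= inner (y
    - z) (p y - p z)]; Cauchy-Schwarz finishes. *)
Lemma proj_nonexpansive y z : enorm (p y - p z) <= enorm (y - z).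
Proof.
have [->|pyz] := eqVneq (enorm (p y - p z)) 0; first exact: enorm_ge0.
have py0 : 0 < enorm (p y - p z) by rewrite lt_neqAle eq_sym pyz enorm_ge0.
rewrite -(ler_pM2r py0) -expr2.
apply: le_trans (le_trans (ler_norm _) (cauchy_schwarz _ _)).
have h1 := proj_variational y (pX z).1.
have h2 := proj_variational z (pX y).1.
rewrite enorm_sqr -subr_ge0.
suff -> : inner (y - z) (p y - p z) - inner (p y - p z) (p y - p z) =
   - (inner (y - p y) (p z - p y) + inner (z - p z) (p y - p z)).
  by rewrite oppr_ge0; lra.
rewrite !innerBl !innerBr (innerC (p z) (p y)); ring.
Qed.

Lemma proj_id x : X x -> p x = x.
Proof.
move=> Xx; apply/esym/eqP; rewrite -subr_eq0; apply/eqP/enorm_eq0/eqP.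
rewrite eq_le enorm_ge0 andbT -enorm0; have := (pX x).2 _ Xx; by rewrite subrr.
Qed.

End Projection.

Section Distance.
Variable S : set 'rV[R]_d.

Lemma dist_to_le x z : S z -> dist_to S x <= enorm (x - z).
Proof.
move=> Sz; apply: ge_inf; last by exists z.
by exists 0 => _ [y _ <-]; exact: enorm_ge0.
Qed.

Lemma dist_to_ge0 x : S !=set0 -> 0 <= dist_to S x.
Proof.
case=> z Sz; apply: lb_le_inf; first by exists (enorm (x - z)), z.
by move=> _ [y _ <-]; exact: enorm_ge0.
Qed.

Lemma dist_to_lipschitz x y : S !=set0 ->
  `|dist_to S x - dist_to S y| <= enorm (x - y).
Proof.
case=> z0 Sz0.
suff h u v : dist_to S u <= enorm (u - v) + dist_to S v.
  by rewrite ler_norml; have := h x y; have := h y x; rewrite (enormBC y); lra.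
rewrite -lerBlDl; apply: lb_le_inf; first by exists (enorm (v - z0)), z0.
move=> _ [z Sz <-]; rewrite lerBlDl; apply: le_trans (dist_to_le _ Sz) _.
exact: enorm_triB.
Qed.

Lemma dist_to_attained x : S !=set0 -> compact S ->
  exists2 z, S z & enorm (x - z) = dist_to S x.
Proof.
move=> S0 cS.
have ct : {within S, continuous (fun z => enorm (x - z))}.
  apply: continuous_subspaceT; apply: (@lipschitz_continuous _ 1) => u v.
  rewrite mul1r ler_norml; have := enorm_triB x u v; have := enorm_triB x v u.
  by rewrite (enormBC v); lra.
have [|z /set_mem Sz zmin] := @EVT_min_rV R d (fun z => enorm (x - z)) S S0 cS; first exact: ct.
exists z => //; apply/eqP; rewrite eq_le dist_to_le// andbT.
apply: lb_le_inf; first by exists (enorm (x - z)), z.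
by move=> _ [y Sy <-]; apply: zmin; rewrite inE.
Qed.

End Distance.
End Geometry.

(** * Measurability and independence *)

Section VectorMeasurability.
Variables (R : realType) (d : nat) (dS : measure_display) (S : measurableType dS).

(** Coordinatewise, so that no sigma-algebra on row vectors has to be chosen. *)
Definition vmeasurable (f : S -> 'rV[R]_d) :=
  forall i, measurable_fun setT (fun s => f s 0 i).

Lemma measurable_enorm (f : S -> 'rV[R]_d) :
  vmeasurable f -> measurable_fun setT (fun s => enorm (f s)).
Proof.
move=> mf; apply: (measurableT_comp (continuous_measurable_fun (@sqrt_continuous R))).
by apply: measurable_sum => i; exact: measurable_funX.
Qed.

Lemma rat_rV_dense (x : 'rV[R]_d) (e : R) : 0 < e ->
  exists q : 'rV[rat]_d, enorm (x - map_mx ratr q) < e.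
Proof.
move=> e0; pose e' := e / (d%:R + 1).
have d0 : 0 < d%:R + 1 :> R by rewrite ltr_wpDl.
have e'0 : 0 < e' by exact: divr_gt0.
have h i : exists r : rat, `|x 0 i - ratr r| <= e'.
  have /rat_in_itvoo[r] : x 0 i - e' < x 0 i + e' by lra.
  rewrite inE/= => /andP[/= r1 r2]; exists r; rewrite ler_norml.
  by move: r1 r2; rewrite !bnd_simp; lra.
exists (\row_i sval (cid (h i))).
apply: (@le_lt_trans _ _ (d%:R * e')).
  apply: enorm_le_bound; first exact: ltW.
  by move=> i; rewrite !mxE; case: cid.
by rewrite mulrCA -[ltRHS]mulr1 ltr_pM2l// ltr_pdivrMr// mul1r ltrDl.
Qed.

(* Lipschitz functions are countable infima of [f q + a |x - q|], q rational. *)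
Lemma measurable_lipschitz (phi : 'rV[R]_d -> R) (a : R) (f : S -> 'rV[R]_d) :
  0 <= a -> (forall x y, `|phi x - phi y| <= a * enorm (x - y)) ->
  vmeasurable f -> measurable_fun setT (fun s => phi (f s)).
Proof.
move=> a0 phil mf mS; apply: (measurability _ (RGenInftyO.measurableE R)) => //.
move=> _ [_ [r ->] <-]; rewrite setTI.
rewrite [X in measurable X](_ : _ = \bigcup_(q : 'rV[rat]_d)
   [set s | phi (map_mx ratr q) + a * enorm (f s - map_mx ratr q) < r]).
  apply: countable_bigcupT_measurable; first exact: countableP.
  move=> q; rewrite -[X in measurable X]setTI.
  have mg : measurable_fun setT (fun s => phi (map_mx ratr q) + a * enorm (f s - map_mx ratr q)).
    apply: measurable_funD => //; apply: measurable_funM => //.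
    apply: measurable_enorm => i; under eq_fun do rewrite !mxE.
    exact: measurable_funB.
  have := mg mS _ (measurable_itv `]-oo, r[); congr (measurable (_ `&` _)).
apply/seteqP; split => s /=; rewrite in_itv/=.
  (* Replacing [f s] by [q] costs at most [2 * a] times their distance, once through [phi] and once
     through the cone term; the [+ 1] avoids division by zero. *)
  move=> sr; have k0 : 0 < (r - phi (f s)) / (2 * a + 1).
    by rewrite divr_gt0 ?subr_gt0//; lra.
  have [q qe] := rat_rV_dense (f s) k0; exists q => //=.
  have := phil (f s) (map_mx ratr q); rewrite ler_norml => /andP[h _].
  move: qe; rewrite ltr_pdivlMr; last by lra.
  set n := enorm _ in h *; move=> qe; have n0 : 0 <= n by exact: enorm_ge0. nra.
move=> [q _ /= h]; have := phil (f s) (map_mx ratr q).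
by rewrite ler_norml => /andP[_ h2]; lra.
Qed.

End VectorMeasurability.

(** * Independence and integration over one fresh noise variable *)

Section Independence.
Local Open Scope ereal_scope.
Context (R : realType) (dT dW : measure_display) (T : measurableType dT)
  (W : measurableType dW) (P : probability T R) (mu : probability W R)
  (I : eqType) (w : I -> T -> W).
Hypothesis mw : forall i, measurable_fun setT (w i).
Hypothesis lw : forall i B, measurable B -> P (w i @^-1` B) = mu B.
Hypothesis ind : mutually_independent P w.

Definition preimages (s : seq I) : set (set T) :=
  [set A | exists i (B : set W), i \in s /\ measurable B /\ A = w i @^-1` B].

(** A pi-system generating the same sigma-algebra as [preimages s]; on it, for duplicate-free [s],
    mutual independence is the product formula. *)
Definition cylinders (s : seq I) : set (set T) :=
  [set A | exists2 B : I -> set W, forall i, measurable (B i) &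
           A = \big[setI/setT]_(i <- s) (w i @^-1` (B i))].

Lemma measurable_w i B : measurable B -> measurable (w i @^-1` B).
Proof. by move=> mB; rewrite -[X in measurable X]setTI; exact: mw. Qed.

Lemma preimages_measurable s A : <<s preimages s >> A -> measurable A.
Proof.
apply: smallest_sub; first exact: sigma_algebra_measurable.
by move=> _ [i [B [_ [mB ->]]]]; exact: measurable_w.
Qed.

Lemma cylinders_setI s : setI_closed (cylinders s).
Proof.
move=> _ _ [B mB ->] [C mC ->]; exists (fun i => B i `&` C i).
  by move=> i; exact: measurableI.
by rewrite -big_split.
Qed.

Lemma preimages_sub_cylinders s : uniq s -> preimages s `<=` cylinders s.
Proof.
move=> us _ [i [B [si [mB ->]]]]; exists (fun j => if j == i then B else setT).
  by move=> j; case: ifP.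
rewrite (bigD1_seq i)//= eqxx big1 ?setIT// => j /negbTE ->.
by rewrite preimage_setT.
Qed.

(** Both sides are finite measures in [E] that agree on the pi-system of cylinders, hence on the
    sigma-algebra it generates. *)
Lemma preimages_independent s j C E : uniq s -> j \notin s -> measurable C ->
  <<s preimages s >> E -> P (E `&` w j @^-1` C) = P E * mu C.
Proof.
move=> us js mC sE; have mD := measurable_w j mC.
have muC : mu C = (NngNum (fine_ge0 (measure_ge0 mu C)))%:num%:E.
  by rewrite /= fineK// fin_num_measure.
rewrite muC muleC.
apply: (@g_sigma_algebra_measure_unique _ _ _ (cylinders s) _ (fun=> setT) _ _
  (mrestr P mD) (mscale (NngNum (fine_ge0 (measure_ge0 mu C))) P) (@cylinders_setI s)).
- move=> _ [B mB ->]; rewrite big_seq; apply: bigsetI_measurable => i _; exact: measurable_w.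
- by move=> _; exists (fun=> setT) => //; rewrite big1.
- by rewrite bigcup_const.
- move=> _ [B mB ->]; rewrite /= /mrestr /mscale -muC.
  (* Placing [C] at the new index [j] lets independence be applied to [j :: s]. *)
  pose B' i := if i == j then C else B i.
  have B'B i : i \in s -> B' i = B i.
    by rewrite /B'; case: eqVneq => // ->; rewrite (negbTE js).
  have mB' i : measurable (B' i) by rewrite /B'; case: ifP.
  have := ind (s := j :: s) (B := B'); rewrite /= us js => /(_ isT mB').
  have Bj : B' j = C by rewrite /B' eqxx.
  have := ind us mB'; rewrite !big_cons Bj lw// setIC.
  rewrite (eq_big_seq (fun i => w i @^-1` B i)) => [|i si]; last by rewrite B'B.
  by move=> <- ->.
- by move=> _; rewrite /= /mrestr setTI; apply: le_lt_trans (probability_le1 _ _) _; rewrite ?ltry.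
- move: E sE; apply: smallest_sub; first exact: smallest_sigma_algebra.
  by apply: subset_trans (preimages_sub_cylinders us) _; exact: sub_sigma_algebra.
Qed.

(** The identity, seen as a random element of the sigma-algebra of [s], is independent of [w j].
    Their joint law is thus a product, and Tonelli integrates the fresh noise with the past held
    fixed. *)
Lemma freeze s j : uniq s -> j \notin s ->
  forall Phi : g_sigma_algebraType (preimages s) * W -> \bar R,
  measurable_fun setT Phi -> (forall z, 0 <= Phi z) ->
  \int[P]_om Phi (om, w j om) = \int[P]_om \int[mu]_v Phi (om, v).
Proof.
move=> us js Phi mPhi Phi0.
pose F : measurableType _ := g_sigma_algebraType (preimages s).
have mid : measurable_fun setT (fun om : T => om : F).
  by move=> _ A mA; rewrite setTI; exact: preimages_measurable mA.
have mpair : measurable_fun setT (fun om : T => (om : F, w j om)).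
  exact: measurable_fun_pair.
pose idF : {mfun T >-> F} :=
  HB.pack (fun om : T => om : F) (isMeasurableFun.Build _ _ _ _ _ mid).
pose pr : {mfun T >-> (F * W)%type} :=
  HB.pack (fun om : T => (om : F, w j om)) (isMeasurableFun.Build _ _ _ _ _ mpair).
have prodE (A : set (F * W)) : measurable A -> (distribution P idF \x mu) A = distribution P pr A.
  apply: product_measure_unique => A' B mA mB.
  rewrite /distribution /pushforward/= -(preimages_independent us js mB mA).
  by [].
transitivity (\int[distribution P pr]_z Phi z).
  by rewrite ge0_integral_distribution.
transitivity (\int[distribution P idF \x mu]_z Phi z).
  by apply: eq_measure_integral => A mA _; apply/esym; exact: prodE.
rewrite fubini_tonelli1// ge0_integral_distribution//.
- exact: measurable_fun_fubini_tonelli_F.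
- by move=> om; exact: integral_ge0.
Qed.

End Independence.

(** * One step from a fixed point *)

(* Neither [h] nor [k] need be integrable: only the negative part of [g] changes side. *)
Lemma ge0_integral_leD (R : realType) (dW : measure_display) (W : measurableType dW)
    (mu : {measure set W -> \bar R}) (h k : W -> \bar R) (g : W -> R) :
  measurable_fun setT h -> measurable_fun setT k ->
  (forall x, 0 <= h x)%E -> (forall x, 0 <= k x)%E ->
  mu.-integrable setT (EFin \o g) ->
  (forall x, h x + (g x)%:E <= k x)%E ->
  (\int[mu]_x h x + \int[mu]_x (g x)%:E <= \int[mu]_x k x)%E.
Proof.
move=> mh mk h0 k0 ig hgk.
have mg : measurable_fun setT (EFin \o g) := measurable_int _ ig.
have pfin := integrable_pos_fin_num measurableT ig.
have nfin := integrable_neg_fin_num measurableT ig.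
have mgp := measurable_funepos mg; have mgn := measurable_funeneg mg.
rewrite [X in (_ + X)%E]integralE addeA leeBlDr//.
rewrite -!ge0_integralD//; apply: ge0_le_integral => //.
- by move=> x _; rewrite adde_ge0.
- exact: emeasurable_funD.
- exact: emeasurable_funD.
- move=> x _; rewrite funeposE funenegE /=; have := hgk x.
  have [g0|/ltW g0] := leP 0 (g x).
    rewrite max_l ?lee_fin// max_r ?lee_fin ?oppr_le0//.
    by rewrite adde0.
  by rewrite max_r ?lee_fin// max_l ?lee_fin ?oppr_ge0// adde0 EFinN leeBrDr.
Qed.

(** * Elementary exponential inequalities *)

Section ExpInequalities.
Variable R : realType.
Implicit Types x y b : R.

(** From [1 - y <= expR (- y)] follows [expR y <= 1 + y * expR y], and [y * (expR y - 1)] is at most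
    [y ^+ 2 * expR b] for either sign of [y]. *)
Lemma expR_le_quad y b : `|y| <= b -> expR y <= 1 + y + y ^+ 2 * expR b.
Proof.
move=> yb; have h : expR y <= 1 + y * expR y.
  have := expR_ge1Dx (- y); have := expR_gt0 y; rewrite expRN => e0 h.
  have : (1 - y) * expR y <= 1 by rewrite -ler_pdivlMr// mul1r.
  lra.
have eb : expR y <= expR b by rewrite ler_expR; apply: le_trans yb; exact: ler_norm.
have e1 : 1 <= expR b by rewrite -expR0 ler_expR; apply: le_trans yb.
have := expR_ge1Dx y; have [y0|y0] := leP 0 y; nra.
Qed.

Lemma sqr_le_expR x : 0 <= x -> x ^+ 2 <= 2 * expR x.
Proof.
move=> x0; have := expR_ge1Dxn 1 x0; rewrite (_ : (1.+1)`!%:R = 2 :> R) => [h|]; last by [].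
by lra.
Qed.

End ExpInequalities.

(** * Pointwise drift of the distance to a fixed minimiser *)

Section Drift.
Variables (R : realType) (d : nat) (X : set 'rV[R]_d) (proj : 'rV[R]_d -> 'rV[R]_d).
Hypotheses (cX : convex_set X) (pX : is_proj X proj).

Lemma proj_step_sqr (x xs c : 'rV[R]_d) (al : R) : X xs ->
  enorm (proj (x - al *: c) - xs) ^+ 2 <=
    enorm (x - xs) ^+ 2 - 2 * al * inner c (x - xs) + al ^+ 2 * enorm c ^+ 2.
Proof.
move=> Xxs; have := proj_nonexpansive cX pX (x - al *: c) xs.
rewrite (proj_id pX Xxs) -(@ler_pXn2r _ 2)// ?nnegrE ?enorm_ge0// => h.
apply: (le_trans h).
rewrite (addrAC x) (enorm_sqrB (x - xs)) enormZ exprMn real_normK ?num_real// innerZr (innerC _ c).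
by rewrite mulrA.
Qed.

(** The right side involves [c] only through a linear term and through [expR (lam * enorm c)], the
    two quantities whose means are controlled later. Being at distance at least [B * al] tames the
    second-order term of the step. *)
Lemma drift_ineq (x xs c : 'rV[R]_d) (al th lam B : R) :
  X x -> X xs -> 0 < al -> 0 <= th -> 0 < lam -> 0 < B ->
  B * al <= enorm (x - xs) -> th * al <= lam / 2 ->
  expR (th * (enorm (proj (x - al *: c) - xs) - enorm (x - xs))) <=
    1 - th * al * (inner c (x - xs) / enorm (x - xs))
      + (th * al / (lam ^+ 2 * B) + 8 * (th * al) ^+ 2 / lam ^+ 2) * expR (lam * enorm c).
Proof.
move=> Xx Xxs al0 th0 lam0 B0 BD tal.
have := proj_step_sqr x c al Xxs.
have rn : `|enorm (proj (x - al *: c) - xs) - enorm (x - xs)| <= al * enorm c.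
  have h : enorm (proj (x - al *: c) - x) <= al * enorm c.
    have := proj_nonexpansive cX pX (x - al *: c) x.
    by rewrite (proj_id pX Xx) addrAC subrr sub0r enormN enormZ gtr0_norm.
  have := enorm_triB (proj (x - al *: c)) x xs.
  have := enorm_triB x (proj (x - al *: c)) xs.
  by rewrite (enormBC x (proj _)) ler_norml; lra.
set D := enorm (x - xs) in BD rn *.
set D' := enorm (proj _ - xs) in rn *.
set n := enorm c in rn *; set i := inner c _ => sq.
have n0 : 0 <= n := enorm_ge0 c.
have D0 : 0 < D by apply: lt_le_trans BD; exact: mulr_gt0.
set r := D' - D in rn *.
(* In [D' ^+ 2 - D ^+ 2 = 2 * D * r + r ^+ 2] the square is dropped; after division by [2 * D], the
   factor [al / (2 * D)] is at most [1 / (2 * B)]. *)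
have r_le : r <= - (al * (i / D)) + al * n ^+ 2 / (2 * B).
  have h1 : 2 * D * r <= - 2 * al * i + al ^+ 2 * n ^+ 2.
    have : 0 <= r ^+ 2 by exact: sqr_ge0.
    by rewrite /r in sq *; nra.
  have : r <= (- 2 * al * i + al ^+ 2 * n ^+ 2) / (2 * D).
    by rewrite ler_pdivlMr ?mulr_gt0// mulrC.
  move/le_trans; apply.
  have -> : (- 2 * al * i + al ^+ 2 * n ^+ 2) / (2 * D) =
     - (al * (i / D)) + al * n ^+ 2 * (al / (2 * D)) by field; rewrite gt_eqF.
  rewrite lerD2l -[leRHS]mulrA.
  have anz : 0 <= al * n ^+ 2 by rewrite mulr_ge0 ?sqr_ge0 ?ltW.
  rewrite -mulrA; apply: (ler_wpM2l (ltW al0)); apply: (ler_wpM2l (sqr_ge0 n)).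
  by rewrite ler_pdivrMr ?mulr_gt0// ler_pdivlMl ?mulr_gt0//; nra.
set E := expR (lam * n).
have E0 : 0 < E by exact: expR_gt0.
have n2E : n ^+ 2 <= 2 / lam ^+ 2 * E.
  have := sqr_le_expR (mulr_ge0 (ltW lam0) n0); rewrite exprMn -/E => h.
  by rewrite mulrAC ler_pdivlMr ?exprn_gt0// mulrC.
(* The exponential is split into two halves: one absorbs [n ^+ 2], the other dominates
   [expR (th * al * n)] because [th * al <= lam / 2]. *)
have n2EE : n ^+ 2 * expR (th * al * n) <= 8 / lam ^+ 2 * E.
  have l2 : 0 <= lam / 2 by lra.
  have h := sqr_le_expR (mulr_ge0 l2 n0).
  have h2 : expR (th * al * n) <= expR (lam / 2 * n) by rewrite ler_expR ler_wpM2r.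
  have -> : E = expR (lam / 2 * n) * expR (lam / 2 * n).
    by rewrite -expRD /E; congr expR; field.
  rewrite mulrA; apply: ler_pM => //; rewrite ?sqr_ge0 ?expR_ge0//.
  rewrite mulrAC ler_pdivlMr ?exprn_gt0//.
  by move: h; rewrite exprMn expr_div_n; set e := expR _; lra.
have yb : `|th * r| <= th * al * n.
  by rewrite normrM ger0_norm// -mulrA ler_wpM2l.
apply: (le_trans (expR_le_quad yb)).
have y2 : (th * r) ^+ 2 * expR (th * al * n) <= 8 * (th * al) ^+ 2 / lam ^+ 2 * E.
  apply: (@le_trans _ _ ((th * al) ^+ 2 * (n ^+ 2 * expR (th * al * n)))).
    rewrite mulrA ler_wpM2r ?expR_ge0// -exprMn -[leLHS]real_normK ?num_real//.
    by rewrite ler_pXn2r ?nnegrE// mulr_ge0// mulr_ge0// ltW.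
  have -> : 8 * (th * al) ^+ 2 / lam ^+ 2 * E = (th * al) ^+ 2 * (8 / lam ^+ 2 * E).
    by field; rewrite gt_eqF.
  by rewrite ler_wpM2l ?sqr_ge0.
have y1 : th * r <= - (th * al * (i / D)) + th * al / (lam ^+ 2 * B) * E.
  apply: (le_trans (ler_wpM2l th0 r_le)).
  rewrite mulrDr mulrN [th * (al * (i / D))]mulrA lerD2l.
  have -> : th * al / (lam ^+ 2 * B) * E = th * al / (2 * B) * (2 / lam ^+ 2 * E).
    by field; rewrite !gt_eqF.
  have -> : th * (al * n ^+ 2 / (2 * B)) = th * al / (2 * B) * n ^+ 2.
    by field; rewrite gt_eqF.
  apply: ler_wpM2l => //; apply: divr_ge0; last by lra.
  by rewrite mulr_ge0// ltW.
by rewrite [X in _ <= _ + X]mulrDl; lra.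
Qed.

End Drift.

(** * Drift in the mean over the two noises, at a fixed point *)

Section Step.
Context (R : realType) (d : nat) (dW : measure_display) (W : measurableType dW)
  (mu : probability W R) (X : set 'rV[R]_d) (proj : 'rV[R]_d -> 'rV[R]_d)
  (S : set 'rV[R]_d) (l : 'rV[R]_d -> W -> R) (nu : R).
Let lbar x := fine (\int[mu]_w (l x w)%:E)%E.
Hypotheses (cX : convex_set X) (pX : is_proj X proj) (S0 : S !=set0) (SX : S `<=` X).
Hypothesis ml : measurable_fun setT
  (fun p : (d.-tuple R * W)%type => l (\row_i tnth p.1 i) p.2).
Hypothesis il : forall x, mu.-integrable setT (fun w => (l x w)%:E).

(** The noises are free arguments: at [wp t om] and [wm t om] this is [kw_c], while at fixed [x] it
    can be integrated over fresh noise. *)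
Definition fdiff (x : 'rV[R]_d) (w1 w2 : W) : 'rV[R]_d :=
  (2 * nu)^-1 *: \row_(i < d) (l (x + nu *: unitv i) w1 - l (x - nu *: unitv i) w2).

(** The mean of [fdiff x], which is the difference quotient that (D3) compares with the gradient. *)
Definition mean_fdiff (x : 'rV[R]_d) : 'rV[R]_d :=
  (2 * nu)^-1 *: \row_(i < d) (lbar (x + nu *: unitv i) - lbar (x - nu *: unitv i)).

Section Measurability.
Context (dS : measure_display) (Sp : measurableType dS).
Variables (f : Sp -> 'rV[R]_d) (g g1 g2 : Sp -> W).
Hypotheses (mf : vmeasurable f) (mg : measurable_fun setT g).
Hypotheses (mg1 : measurable_fun setT g1) (mg2 : measurable_fun setT g2).

Lemma measurable_noisy : measurable_fun setT (fun s => l (f s) (g s)).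
Proof.
rewrite (_ : (fun s => _) = (fun p : (d.-tuple R * W)%type => l (\row_i tnth p.1 i) p.2)
    \o (fun s => ([tuple f s 0 i | i < d], g s))).
  apply: measurableT_comp => //; apply: measurable_fun_pair => //.
  apply/measurable_fun_tnthP => i; apply: eq_measurable_fun (mf i) => s _ /=.
  by rewrite tnth_mktuple.
apply/funext => s /=; congr (l _ _); apply/rowP => i.
by rewrite !mxE tnth_mktuple.
Qed.

(** Each coordinate of a nonexpansive map is 1-Lipschitz. *)
Lemma vmeasurable_proj : vmeasurable (proj \o f).
Proof.
move=> i; apply: (@measurable_lipschitz _ _ _ _ (fun y => proj y 0 i) 1) => // x y.
rewrite mul1r; apply: le_trans (proj_nonexpansive cX pX x y).
by have := coord_le_enorm (proj x - proj y) i; rewrite !mxE.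
Qed.

Lemma measurable_dist : measurable_fun setT (fun s => dist_to S (f s)).
Proof.
apply: (@measurable_lipschitz _ _ _ _ (dist_to S) 1) => // x y.
by rewrite mul1r; exact: dist_to_lipschitz.
Qed.

End Measurability.

Lemma vmeasurable_fdiff dS (Sp : measurableType dS) (f : Sp -> 'rV[R]_d) (g1 g2 : Sp -> W) :
  vmeasurable f -> measurable_fun setT g1 -> measurable_fun setT g2 ->
  vmeasurable (fun s => fdiff (f s) (g1 s) (g2 s)).
Proof.
move=> mf mg1 mg2 i; under eq_fun do rewrite !mxE.
apply: measurable_funM => //; apply: measurable_funB; apply: measurable_noisy => // j;
  under eq_fun do rewrite !mxE.
- exact: measurable_funD.
- exact: measurable_funB.
Qed.

Definition kw_next (al : R) (x : 'rV[R]_d) w1 w2 := proj (x - al *: fdiff x w1 w2).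

Lemma vmeasurable_kw_next al dS (Sp : measurableType dS) (f : Sp -> 'rV[R]_d) (g1 g2 : Sp -> W) :
  vmeasurable f -> measurable_fun setT g1 -> measurable_fun setT g2 ->
  vmeasurable (fun s => kw_next al (f s) (g1 s) (g2 s)).
Proof.
move=> mf mg1 mg2; apply: vmeasurable_proj => i; under eq_fun do rewrite mxE mxE mxE.
apply: measurable_funB; first exact: mf.
by apply: measurable_funM => //; exact: vmeasurable_fdiff.
Qed.

Lemma measurable_exp_dist th al dS (Sp : measurableType dS) (f : Sp -> 'rV[R]_d) (g1 g2 : Sp -> W) :
  vmeasurable f -> measurable_fun setT g1 -> measurable_fun setT g2 ->
  measurable_fun setT (fun s => (expR (th * dist_to S (kw_next al (f s) (g1 s) (g2 s))))%:E).
Proof.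
move=> mf mg1 mg2; apply/measurable_EFinP; apply: measurableT_comp => //.
apply: measurable_funM => //; apply: measurable_dist; exact: vmeasurable_kw_next.
Qed.

Lemma measurable_exp_fdiff lam dS (Sp : measurableType dS) (f : Sp -> 'rV[R]_d) (g1 g2 : Sp -> W) :
  vmeasurable f -> measurable_fun setT g1 -> measurable_fun setT g2 ->
  measurable_fun setT (fun s => (expR (lam * enorm (fdiff (f s) (g1 s) (g2 s))))%:E).
Proof.
move=> mf mg1 mg2; apply/measurable_EFinP; apply: measurableT_comp => //.
apply: measurable_funM => //; apply: measurable_enorm; exact: vmeasurable_fdiff.
Qed.

Lemma vmeasurable_cst dS (Sp : measurableType dS) (x : 'rV[R]_d) :
  vmeasurable (fun _ : Sp => x).
Proof. by move=> i; exact: measurable_cst. Qed.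

Lemma integral_affine (g : W -> R) (m a b : R) : mu.-integrable setT (EFin \o g) ->
  (\int[mu]_w (g w)%:E = m%:E)%E ->
  mu.-integrable setT (EFin \o (fun w => a + b * g w)) /\
  (\int[mu]_w (a + b * g w)%:E = (a + b * m)%:E)%E.
Proof.
move=> ig gm.
have ia : mu.-integrable setT (EFin \o cst a) by exact: finite_measure_integrable_cst.
have ib : mu.-integrable setT (fun w => (b%:E * (g w)%:E)%E) by exact: integrableZl.
split; first by apply: eq_integrable (integrableD measurableT ia ib).
transitivity (\int[mu]_w (a%:E + b%:E * (g w)%:E))%E; first by apply: eq_integral.
rewrite integralD// integralZl// gm integral_cst//.
by rewrite [X in (_ * X)%E]probability_setT mule1.
Qed.

Lemma integral_inner (y : 'I_d -> 'rV[R]_d) (v : 'rV[R]_d) :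
  mu.-integrable setT (EFin \o (fun w => inner (\row_i l (y i) w) v)) /\
  (\int[mu]_w (inner (\row_i l (y i) w) v)%:E = (inner (\row_i lbar (y i)) v)%:E)%E.
Proof.
pose F (i : 'I_d) (w : W) : \bar R := ((v 0 i)%:E * (l (y i) w)%:E)%E.
have FE w : (inner (\row_i l (y i) w) v)%:E = (\sum_(i < d) F i w)%E.
  by rewrite sumEFin; congr EFin; apply: eq_bigr => i _; rewrite mxE mulrC.
have iF i : mu.-integrable setT (F i) by exact: integrableZl.
split.
  by apply: eq_integrable (integrable_sum _ _ (fun i _ => iF i)) => // w _; rewrite /= FE.
under eq_integral do rewrite FE.
rewrite integral_sum// [in RHS]/inner -sumEFin; apply: eq_bigr => i _.
rewrite integralZl// mxE mulrC EFinM fineK//.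
by apply: integrable_fin_num.
Qed.

(** [ge0_integral_leD] is applied in [w2], then in [w1]. Each noise enters the affine term
    separately, so integrability of [f] and [g] on [W] is enough. *)
Lemma iterated_integral_leD (h k : (W * W)%type -> \bar R) (f g : W -> R) (fb gb p b b' : R) :
  measurable_fun setT h -> measurable_fun setT k ->
  (forall z, 0 <= h z)%E -> (forall z, 0 <= k z)%E ->
  mu.-integrable setT (EFin \o f) -> (\int[mu]_w (f w)%:E = fb%:E)%E ->
  mu.-integrable setT (EFin \o g) -> (\int[mu]_w (g w)%:E = gb%:E)%E ->
  (forall w1 w2, h (w1, w2) + (p + b * f w1 + b' * g w2)%:E <= k (w1, w2))%E ->
  (\int[mu]_w1 \int[mu]_w2 h (w1, w2) + (p + b * fb + b' * gb)%:E <=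
     \int[mu]_w1 \int[mu]_w2 k (w1, w2))%E.
Proof.
move=> mh mk h0 k0 iF eF iG eG pw.
have [ia ea] := integral_affine (p + b' * gb) b iF eF.
rewrite (addrAC p (b * fb)) -ea; apply: ge0_integral_leD => //.
- exact: (measurable_fun_fubini_tonelli_F (m2 := mu) h mh h0).
- exact: (measurable_fun_fubini_tonelli_F (m2 := mu) k mk k0).
- by move=> w1; exact: integral_ge0.
- by move=> w1; exact: integral_ge0.
move=> w1; have [ia2 ea2] := integral_affine (p + b * f w1) b' iG eG.
rewrite (addrAC p (b' * gb)) -ea2; apply: ge0_integral_leD => //; exact: measurableT_comp.
Qed.

(** Integrating [drift_ineq] gives a gain of [2 / 3 * kappa] and losses of [kappa / 6] and
    [kappa / 4], all times [th * al]; what remains is [kappa / 4]. *)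
Lemma mean_exp_decrease (x xs : 'rV[R]_d) (al th lam M B kappa : R) :
  X x -> S xs -> 0 < al -> 0 <= th -> 0 < lam -> 0 < B -> 0 < M -> 0 < kappa ->
  enorm (x - xs) = dist_to S x -> B * al <= enorm (x - xs) ->
  2 / 3 * kappa * enorm (x - xs) <= inner (mean_fdiff x) (x - xs) ->
  th * al <= lam / 2 -> M / (lam ^+ 2 * B) <= kappa / 6 ->
  th * al * (8 * M / lam ^+ 2) <= kappa / 4 ->
  (\int[mu]_w1 \int[mu]_w2 (expR (lam * enorm (fdiff x w1 w2)))%:E <= M%:E)%E ->
  (\int[mu]_w1 \int[mu]_w2 (expR (th * dist_to S (kw_next al x w1 w2)))%:E <=
     ((1 - kappa / 4 * (th * al)) * expR (th * dist_to S x))%:E)%E.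
Proof.
move=> Xx Sxs al0 th0 lam0 B0 M0 kap0 xsx BD inn thal MB thM GM.
set D := enorm (x - xs) in xsx BD inn *; rewrite -xsx.
have D0 : 0 < D by apply: lt_le_trans BD; exact: mulr_gt0.
pose E0 := expR (th * D); have E00 : 0 < E0 by exact: expR_gt0.
pose K := th * al / (lam ^+ 2 * B) + 8 * (th * al) ^+ 2 / lam ^+ 2.
have ta0 : 0 <= th * al by rewrite mulr_ge0// ltW.
have K0 : 0 <= K.
  rewrite addr_ge0// divr_ge0 ?mulr_ge0 ?sqr_ge0 ?exprn_ge0//; exact: ltW.
pose b := E0 * (th * al / D) * (2 * nu)^-1.
pose f w := inner (\row_i l (x + nu *: unitv i) w) (x - xs).
pose g w := inner (\row_i l (x - nu *: unitv i) w) (x - xs).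
have [iF eF] := integral_inner (fun i => x + nu *: unitv i) (x - xs).
have [iG eG] := integral_inner (fun i => x - nu *: unitv i) (x - xs).
set fb := inner _ _ in eF; set gb := inner _ _ in eG.
rewrite -/f in iF eF; rewrite -/g in iG eG.
have fdE w1 w2 : inner (fdiff x w1 w2) (x - xs) = (2 * nu)^-1 * (f w1 - g w2).
  rewrite /fdiff innerZl; congr (_ * _); rewrite -innerBl; congr inner.
  by apply/rowP => i; rewrite !mxE.
have mfdE : inner (mean_fdiff x) (x - xs) = (2 * nu)^-1 * (fb - gb).
  rewrite /mean_fdiff innerZl; congr (_ * _); rewrite -innerBl; congr inner.
  by apply/rowP => i; rewrite !mxE.
have mW1 : measurable_fun setT (fst : (W * W)%type -> W) by exact: measurable_fst.
have mW2 : measurable_fun setT (snd : (W * W)%type -> W) by exact: measurable_snd.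
pose h z : \bar R := (expR (th * dist_to S (kw_next al x z.1 z.2)))%:E.
pose k z : \bar R := (expR (lam * enorm (fdiff x z.1 z.2)))%:E.
have mh : measurable_fun [set: (W * W)%type] h.
  by apply: measurable_exp_dist => //; exact: vmeasurable_cst.
have mk : measurable_fun [set: (W * W)%type] k.
  by apply: measurable_exp_fdiff => //; exact: vmeasurable_cst.
have h0 z : (0 <= h z)%E by rewrite lee_fin expR_ge0.
have k0 z : (0 <= k z)%E by rewrite lee_fin expR_ge0.
have EK0 : 0 <= E0 * K by rewrite mulr_ge0// ltW.
(* The distance to [S] is at most the distance to [xs]. The linear part of the drift inequality,
   scaled by [E0], is kept on the left so that both outer terms are nonnegative. *)
have pw w1 w2 : (h (w1, w2) + (- E0 + b * f w1 + (- b) * g w2)%:E <= (E0 * K)%:E * k (w1, w2))%E.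
  rewrite -EFinD -EFinM lee_fin.
  have := drift_ineq cX pX (fdiff x w1 w2) Xx (SX Sxs) al0 th0 lam0 B0 BD thal.
  rewrite -/D fdE -/K -/(kw_next al x w1 w2) => di.
  have : expR (th * dist_to S (kw_next al x w1 w2)) <=
      E0 * expR (th * (enorm (kw_next al x w1 w2 - xs) - D)).
    by rewrite -expRD ler_expR -mulrDr addrC subrK ler_wpM2l// dist_to_le.
  move=> hn; have := le_trans hn (ler_wpM2l (ltW E00) di).
  rewrite -lerBrDr => /le_trans; apply; rewrite le_eqVlt; apply/orP; left; apply/eqP.
  by rewrite /b; ring.
have mk' : measurable_fun setT (fun z => (E0 * K)%:E * k z)%E by exact: measurable_funeM.
have k'0 z : (0 <= (E0 * K)%:E * k z)%E by rewrite mule_ge0.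
have st1 := iterated_integral_leD mh mk' h0 k'0 iF eF iG eG pw.
have {}st1 : (\int[mu]_w1 \int[mu]_w2 h (w1, w2) + (- E0 + b * fb + (- b) * gb)%:E
               <= (E0 * K * M)%:E)%E.
  apply: (le_trans st1); under eq_integral => w1 _.
    rewrite ge0_integralZl//; last exact: measurableT_comp.
    over.
  rewrite ge0_integralZl//; last 2 first.
  - exact: (measurable_fun_fubini_tonelli_F (m2 := mu) k mk k0).
  - by move=> w1 _; exact: integral_ge0.
  by rewrite (EFinM (E0 * K) M) lee_wpmul2l.
move: st1; rewrite -leeBrDr// => /le_trans; apply.
rewrite -EFinB lee_fin.
have inn' : 2 / 3 * kappa <= inner (mean_fdiff x) (x - xs) / D by rewrite ler_pdivlMr.
have -> : E0 * K * M - (- E0 + b * fb + - b * gb) =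
   E0 * (1 + K * M - th * al * (inner (mean_fdiff x) (x - xs) / D)).
  by rewrite mfdE /b; ring.
rewrite mulrC ler_pM2r//.
have KM : K * M <= th * al * (kappa / 6 + kappa / 4).
  have -> : K * M = th * al * (M / (lam ^+ 2 * B) + th * al * (8 * M / lam ^+ 2)).
    by rewrite /K; field; rewrite !gt_eqF.
  by rewrite ler_wpM2l// lerD.
have := ler_wpM2l ta0 inn'; lra.
Qed.

End Step.

Section IteratedIntegral.
Context (R : realType) (dW : measure_display) (W : measurableType dW) (mu : probability W R).
Variables (h k : (W * W)%type -> \bar R).
Hypotheses (mh : measurable_fun setT h) (mk : measurable_fun setT k).
Hypotheses (h0 : forall z, (0 <= h z)%E) (k0 : forall z, (0 <= k z)%E).

Lemma iterated_integral_le : (forall w1 w2, h (w1, w2) <= k (w1, w2))%E ->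
  (\int[mu]_w1 \int[mu]_w2 h (w1, w2) <= \int[mu]_w1 \int[mu]_w2 k (w1, w2))%E.
Proof.
move=> hk; apply: ge0_le_integral => //.
- by move=> w1 _; exact: integral_ge0.
- exact: (measurable_fun_fubini_tonelli_F (m2 := mu) h mh h0).
- exact: (measurable_fun_fubini_tonelli_F (m2 := mu) k mk k0).
by move=> w1 _; apply: ge0_le_integral => //; exact: measurableT_comp.
Qed.

Lemma iterated_integralZl (r : R) : 0 <= r ->
  (\int[mu]_w1 \int[mu]_w2 (r%:E * k (w1, w2)) =
   r%:E * \int[mu]_w1 \int[mu]_w2 k (w1, w2))%E.
Proof.
move=> r0; rewrite -ge0_integralZl//.
- by apply: eq_integral => w1 _; rewrite ge0_integralZl//; exact: measurableT_comp.
- exact: (measurable_fun_fubini_tonelli_F (m2 := mu) k mk k0).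
- by move=> w1 _; exact: integral_ge0.
Qed.

End IteratedIntegral.

(** * One-step bound, near and far from the minimisers *)

Section StepBound.
Context (R : realType) (d : nat) (dW : measure_display) (W : measurableType dW)
  (mu : probability W R) (X : set 'rV[R]_d) (proj : 'rV[R]_d -> 'rV[R]_d)
  (S : set 'rV[R]_d) (l : 'rV[R]_d -> W -> R) (nu : R).
Hypotheses (cX : convex_set X) (pX : is_proj X proj) (S0 : S !=set0) (SX : S `<=` X).
Hypothesis ml : measurable_fun setT
  (fun p : (d.-tuple R * W)%type => l (\row_i tnth p.1 i) p.2).
Hypothesis il : forall x, mu.-integrable setT (fun w => (l x w)%:E).
Variables (lam M B kappa eta : R).
Hypotheses (lam0 : 0 < lam) (M0 : 0 < M) (B0 : 0 < B) (kappa0 : 0 < kappa).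
Hypotheses (MB : M / (lam ^+ 2 * B) <= kappa / 6) (etalam : eta <= lam / 2)
  (etaM : eta * (8 * M / lam ^+ 2) <= kappa / 4) (etakappa : kappa / 4 * eta <= 1).

(** Far from [S] the mean decreases by [mean_exp_decrease]. Within [B * al] of it, the next distance
    is at most [B * al + al * enorm c], whose exponential moment is bounded by a constant. *)
Lemma mean_exp_step (x : 'rV[R]_d) (al th : R) :
  X x -> 0 < al -> 0 <= th -> th * al <= eta ->
  (exists xs, [/\ S xs, enorm (x - xs) = dist_to S x &
     2 / 3 * kappa * enorm (x - xs) <= inner (mean_fdiff mu l nu x) (x - xs)]) ->
  (\int[mu]_w1 \int[mu]_w2 (expR (lam * enorm (fdiff l nu x w1 w2)))%:E <= M%:E)%E ->
  (\int[mu]_w1 \int[mu]_w2 (expR (th * dist_to S (kw_next proj l nu al x w1 w2)))%:E <=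
     ((1 - kappa / 4 * (th * al)) * expR (th * dist_to S x) + expR (eta * B) * M)%:E)%E.
Proof.
move=> Xx al0 th0 tale [xs [Sxs xsx inn]] GM.
have ta0 : 0 <= th * al by rewrite mulr_ge0// ltW.
have N0 : 0 <= expR (eta * B) * M by rewrite mulr_ge0 ?expR_ge0// ltW.
have [BD|DB] := leP (B * al) (enorm (x - xs)).
  apply: (@le_trans _ _ ((1 - kappa / 4 * (th * al)) * expR (th * dist_to S x))%:E).
    apply: (mean_exp_decrease cX pX S0 SX ml il Xx Sxs al0 th0 lam0 B0 M0 kappa0
      xsx BD inn _ MB) => //.
      exact: le_trans etalam.
    apply: le_trans etaM; apply: ler_wpM2r => //.
    by rewrite divr_ge0 ?sqr_ge0 ?mulr_ge0// ltW.
  by rewrite lee_fin lerDl.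
apply: (@le_trans _ _ (expR (eta * B) * M)%:E); last first.
  rewrite lee_fin lerDr mulr_ge0 ?expR_ge0// subr_ge0.
  apply: le_trans etakappa; apply: ler_wpM2l => //.
  exact/divr_ge0/ler0n/ltW.
have mW1 : measurable_fun setT (fst : (W * W)%type -> W) by exact: measurable_fst.
have mW2 : measurable_fun setT (snd : (W * W)%type -> W) by exact: measurable_snd.
pose h z : \bar R := (expR (th * dist_to S (kw_next proj l nu al x z.1 z.2)))%:E.
pose k z : \bar R := (expR (lam * enorm (fdiff l nu x z.1 z.2)))%:E.
have mh : measurable_fun [set: (W * W)%type] h.
  apply: (measurable_exp_dist nu cX pX S0 ml th al _ mW1 mW2); exact: vmeasurable_cst.
have mk : measurable_fun [set: (W * W)%type] k.
  apply: (measurable_exp_fdiff nu ml lam _ mW1 mW2); exact: vmeasurable_cst.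
have h0 z : (0 <= h z)%E by rewrite lee_fin expR_ge0.
have k0 z : (0 <= k z)%E by rewrite lee_fin expR_ge0.
have mk' : measurable_fun setT (fun z => (expR (eta * B))%:E * k z)%E by exact: measurable_funeM.
have k'0 z : (0 <= (expR (eta * B))%:E * k z)%E by rewrite mule_ge0// lee_fin expR_ge0.
have pw w1 w2 : (h (w1, w2) <= (expR (eta * B))%:E * k (w1, w2))%E.
  rewrite -EFinM lee_fin /= -expRD ler_expR.
  set c := fdiff _ _ _ _ _.
  have h1 : dist_to S (kw_next proj l nu al x w1 w2) <= enorm (x - xs) + al * enorm c.
    apply: (le_trans (dist_to_le _ Sxs)).
    have := enorm_triB (kw_next proj l nu al x w1 w2) x xs.
    have := proj_nonexpansive cX pX (x - al *: c) x.
    rewrite (proj_id pX Xx) addrAC subrr sub0r enormN enormZ gtr0_norm//.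
    rewrite -/(kw_next proj l nu al x w1 w2); lra.
  apply: (le_trans (ler_wpM2l th0 h1)); rewrite mulrDr; apply: lerD.
    have := ler_wpM2l th0 (ltW DB) => /le_trans; apply.
    by rewrite mulrCA mulrC; apply: ler_wpM2r => //; exact: ltW.
  rewrite mulrA; apply: ler_wpM2r; first exact: enorm_ge0.
  by have := lam0; have := etalam; lra.
apply: (le_trans (iterated_integral_le mu mh mk' h0 k'0 pw)).
rewrite iterated_integralZl ?expR_ge0// EFinM lee_wpmul2l// lee_fin expR_ge0//.
Qed.

End StepBound.

(** On the set where [G] is at least [M + n.+1%:R^-1], the hypothesis forces measure zero; these
    sets exhaust the points where [G] exceeds [M]. *)
Lemma ae_le_of_integral_le (R : realType) (dT : measure_display) (T : measurableType dT)
    (P : probability T R) (G : T -> \bar R) (M : R) :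
  0 <= M -> measurable_fun setT G -> (forall x, 0 <= G x)%E ->
  (forall r : R, \int[P]_(x in [set x | r%:E <= G x]) G x <= M%:E * P [set x | r%:E <= G x])%E ->
  {ae P, forall x, (G x <= M%:E)%E}.
Proof.
move=> M0 mG G0 GM; pose A n := [set x | ((M + n.+1%:R^-1)%:E <= G x)%E].
have mA n : measurable (A n).
  have := mG measurableT _ (emeasurable_itv `[(M + n.+1%:R^-1)%:E, +oo[%E).
  rewrite setTI; congr measurable; apply/seteqP; split => x /=; rewrite in_itv/= andbT//.
have PA n : P (A n) = 0%E.
  have h := GM (M + n.+1%:R^-1); rewrite -/(A n) in h.
  have : ((M + n.+1%:R^-1)%:E * P (A n) <= M%:E * P (A n))%E.
    apply: le_trans h; rewrite -integral_cst//; apply: ge0_le_integral => //.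
    - by move=> x _; rewrite lee_fin addr_ge0.
    - exact: measurable_funS mG.
  rewrite -(fineK (fin_num_measure P _ (mA n))) -!EFinM lee_fin mulrDl gerDl.
  rewrite pmulr_rle0 ?invr_gt0// => p0.
  by apply/eqP; rewrite eqe eq_le p0 fine_ge0.
apply: (@negligibleS _ _ _ P (\bigcup_n A n)).
  move=> x /= /negP; rewrite -ltNge => Mx.
  have [r r0 rx] : exists2 r : R, 0 < r & ((M + r)%:E <= G x)%E.
    (* [G] may be infinite, in which case any positive margin works. *)
    case: (G x) Mx (G0 x) => [y| |]//; last by exists 1; rewrite ?leey.
    by rewrite lte_fin => My _; exists (y - M); rewrite ?subr_gt0// lee_fin; lra.
  have [n nr] := ltr_add_invr r0.
  rewrite add0r in nr; exists n => //=; apply: le_trans rx.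
  by rewrite lee_fin lerD2l ltW.
by apply: negligible_bigcup => n; exists (A n); split; [exact: mA|exact: PA|exact: subset_refl].
Qed.

(** * The Kiefer-Wolfowitz process *)

Section Process.
Context (R : realType) (d : nat) (dT dW : measure_display) (T : measurableType dT)
  (W : measurableType dW) (P : probability T R) (mu : probability W R)
  (wp wm : nat -> T -> W) (X : set 'rV[R]_d) (proj : 'rV[R]_d -> 'rV[R]_d)
  (x0 : 'rV[R]_d) (l : 'rV[R]_d -> W -> R) (nu : R) (alpha : nat -> R).
Hypotheses (cX : convex_set X) (pX : is_proj X proj) (Xx0 : X x0).
Hypotheses (mwp : forall t, measurable_fun setT (wp t))
  (mwm : forall t, measurable_fun setT (wm t)).
Hypotheses (lwp : forall t B, measurable B -> P (wp t @^-1` B) = mu B)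
  (lwm : forall t B, measurable B -> P (wm t @^-1` B) = mu B).
Hypothesis ind : mutually_independent P (wfam wp wm).
Hypothesis ml : measurable_fun setT
  (fun p : (d.-tuple R * W)%type => l (\row_i tnth p.1 i) p.2).
Let x_ := kw_iter l nu alpha proj x0 wp wm.

(** A finite duplicate-free list of the noise indices before [t], in the form that
    [mutually_independent] expects. *)
Definition past (t : nat) : seq (nat * bool) :=
  [seq (i, b) | i <- iota 0 t, b <- [:: true; false]].

Lemma mem_past t i b : ((i, b) \in past t) = (i < t)%N.
Proof.
apply/allpairsP/idP => [[[j c] /= [jt _ [-> _]]]|it].
  by move: jt; rewrite mem_iota.
by exists (i, b); split => //=; [rewrite mem_iota | case: b].
Qed.

Lemma uniq_past t : uniq (past t).
Proof. by apply: allpairs_uniq => //; [exact: iota_uniq | move=> [? ?] [? ?]]. Qed.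

Lemma kw_filtrationE t : kw_filtration wp wm t = <<s preimages (wfam wp wm) (past t) >>.
Proof.
rewrite /kw_filtration; congr (<<s _ >>); apply/seteqP; split => A /= [[i b] [B]].
  by move=> [it [mB ->]]; exists (i, b), B; rewrite mem_past.
by rewrite mem_past => -[it [mB ->]]; exists (i, b), B.
Qed.

Lemma measurable_wfam i : measurable_fun setT (wfam wp wm i).
Proof. by case: i => i []; [exact: mwp | exact: mwm]. Qed.

Lemma law_wfam i B : measurable B -> P (wfam wp wm i @^-1` B) = mu B.
Proof. by case: i => i [] mB; [exact: lwp | exact: lwm]. Qed.

Section Sigma.
Variable s : seq (nat * bool).
Let F := g_sigma_algebraType (preimages (wfam wp wm) s).

Lemma measurable_wfam_sub i : i \in s ->
  measurable_fun setT (fun om : F => wfam wp wm i om).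
Proof.
move=> si _ B mB; rewrite setTI; apply: sub_sigma_algebra.
by exists i, B.
Qed.

(** The index list [s] stays fixed during the induction, so that all earlier iterates are measured
    by one sigma-algebra. *)
Lemma vmeasurable_kw_iter t : {subset past t <= s} ->
  vmeasurable (fun om : F => x_ t om).
Proof.
elim: t => [_|t ih ts]; first exact: vmeasurable_cst.
apply: (@vmeasurable_kw_next R d dW W X proj l nu cX pX ml (alpha t) _ _
  (fun om : F => x_ t om) (fun om : F => wp t om) (fun om : F => wm t om)).
- by apply: ih => -[i b]; rewrite mem_past => it; apply: ts; rewrite mem_past ltnS ltnW.
- by apply: (@measurable_wfam_sub (t, true)); apply: ts; rewrite mem_past.
- by apply: (@measurable_wfam_sub (t, false)); apply: ts; rewrite mem_past.
Qed.

End Sigma.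

Lemma kw_iter_in t om : X (x_ t om).
Proof. by case: t => //= t; exact: (pX _).1. Qed.

(** [freeze] is used twice: first [wm t] is integrated out with [wp t] counted as past, then [wp t]
    given the true past. *)
Lemma freeze2 t (Phi : T -> W -> W -> \bar R) :
  measurable_fun setT
    (fun z : ((g_sigma_algebraType (preimages (wfam wp wm) (past t)) * W) * W)%type =>
       Phi z.1.1 z.1.2 z.2) ->
  (forall om w1 w2, 0 <= Phi om w1 w2)%E ->
  (\int[P]_om Phi om (wp t om) (wm t om) =
     \int[P]_om \int[mu]_w1 \int[mu]_w2 Phi om w1 w2)%E.
Proof.
move=> mPhi Phi0.
pose F := g_sigma_algebraType (preimages (wfam wp wm) (past t)).
pose s := (t, true) :: past t.
pose F' := g_sigma_algebraType (preimages (wfam wp wm) s).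
have us : uniq s by rewrite /= uniq_past mem_past ltnn.
have mid : measurable_fun setT (fun om : F' => om : F).
  move=> _ A mA; rewrite setTI; move: A mA.
  apply: smallest_sub; first exact: (@sigma_algebra_measurable _ F').
  move=> _ [i [B [si [mB ->]]]]; apply: sub_sigma_algebra; exists i, B.
  by rewrite inE si orbT.
have mm : measurable_fun setT (fun z : (F' * W)%type => ((z.1 : F, wp t z.1), z.2)).
  apply: measurable_fun_pair => //; apply: measurable_fun_pair.
    by apply: (measurableT_comp mid); exact: measurable_fst.
  apply: (@measurableT_comp _ _ _ _ _ _ (fun om : F' => wp t om)).
    by apply: (@measurable_wfam_sub s (t, true)); rewrite inE eqxx.
  exact: measurable_fst.
have sj : (t, false) \notin s by rewrite inE xpair_eqE andbF mem_past ltnn.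
have tj : (t, true) \notin past t by rewrite mem_past ltnn.
have h1 := freeze measurable_wfam law_wfam ind us sj
  (Phi := fun z : (F' * W)%type => Phi z.1 (wp t z.1) z.2) (measurableT_comp mPhi mm)
  (fun z => Phi0 _ _ _).
have mPhi1 : measurable_fun setT (fun z : (F * W)%type => \int[mu]_w2 Phi z.1 z.2 w2)%E.
  exact: (measurable_fun_fubini_tonelli_F (m2 := mu)
    (fun z : ((F * W) * W)%type => Phi z.1.1 z.1.2 z.2) mPhi (fun z => Phi0 _ _ _)).
have Phi10 (z : F * W) : (0 <= \int[mu]_w2 Phi z.1 z.2 w2)%E by exact: integral_ge0.
have h2 := freeze measurable_wfam law_wfam ind (uniq_past t) tj mPhi1 Phi10.
exact: etrans h1 h2.
Qed.

(** * Conditioning on the past by freezing the iterate *)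

Section Frozen.
Variable t : nat.
Let F := g_sigma_algebraType (preimages (wfam wp wm) (past t)).

Lemma measurable_frozen : let Z := ((F * W) * W)%type in
  [/\ vmeasurable (fun z : Z => x_ t z.1.1), measurable_fun setT (fun z : Z => z.1.2) &
   measurable_fun setT (fun z : Z => z.2)].
Proof.
split => [i| |]; last exact: measurable_snd.
  have := @vmeasurable_kw_iter (past t) t (fun _ h => h) i.
  by move/measurableT_comp; apply; exact: (measurableT_comp measurable_fst measurable_fst).
exact: (measurableT_comp measurable_snd measurable_fst).
Qed.

Lemma exp_moment_frozen (lam M : R) : 0 <= M ->
  cond_exp_le P (kw_filtration wp wm t)
    (fun om => expR (lam * enorm (kw_c l nu wp wm t (x_ t om) om))) M ->
  {ae P, forall om, (\int[mu]_w1 \int[mu]_w2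
     (expR (lam * enorm (fdiff l nu (x_ t om) w1 w2)))%:E <= M%:E)%E}.
Proof.
move=> M0 D2.
pose Phi om w1 w2 : \bar R := (expR (lam * enorm (fdiff l nu (x_ t om) w1 w2)))%:E.
have Phi0 om w1 w2 : (0 <= Phi om w1 w2)%E by rewrite lee_fin expR_ge0.
have [mx m1 m2] := measurable_frozen.
have mPhi : measurable_fun setT (fun z : ((F * W) * W)%type => Phi z.1.1 z.1.2 z.2).
  exact: (measurable_exp_fdiff nu ml lam mx m1 m2).
have mPhi1 : measurable_fun setT (fun z : (F * W)%type => \int[mu]_w2 Phi z.1 z.2 w2)%E.
  exact: (measurable_fun_fubini_tonelli_F (m2 := mu)
    (fun z : ((F * W) * W)%type => Phi z.1.1 z.1.2 z.2) mPhi (fun z => Phi0 _ _ _)).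
have Phi10 om w1 : (0 <= \int[mu]_w2 Phi om w1 w2)%E by exact: integral_ge0.
have mG : measurable_fun setT (fun om : F => \int[mu]_w1 \int[mu]_w2 Phi om w1 w2)%E.
  exact: (measurable_fun_fubini_tonelli_F (m2 := mu)
    (fun z : (F * W)%type => \int[mu]_w2 Phi z.1 z.2 w2)%E mPhi1 (fun z => Phi10 _ _)).
pose G om := (\int[mu]_w1 \int[mu]_w2 Phi om w1 w2)%E.
have G0 om : (0 <= G om)%E by exact: integral_ge0.
have mG' : measurable_fun setT (G : T -> \bar R).
  move=> _ A mA; rewrite setTI; apply: (preimages_measurable measurable_wfam (s := past t)).
  by have := mG measurableT A mA; rewrite setTI.
apply: ae_le_of_integral_le => // r.
set A := [set _ | _].
have FA : <<s preimages (wfam wp wm) (past t) >> A.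
  have := mG measurableT _ (emeasurable_itv `[r%:E, +oo[%E).
  rewrite setTI; congr (_ _); apply/seteqP; split => x /=; rewrite in_itv/= andbT//.
have mA : measurable A := preimages_measurable measurable_wfam FA.
have := D2 A; rewrite kw_filtrationE => /(_ FA); apply: le_trans.
rewrite le_eqVlt; apply/orP; left; apply/eqP/esym.
rewrite integral_mkcond [RHS]integral_mkcond.
(* The indicator of [A] depends on the past only, so [freeze2] localises to [A]. *)
pose Phi' om w1 w2 : \bar R := ((\1_A om)%:E * Phi om w1 w2)%E.
transitivity (\int[P]_om Phi' om (wp t om) (wm t om))%E.
  apply: eq_integral => om _; rewrite /Phi' patchE indicE.
  by case: ifPn => _; rewrite ?mul1e ?mul0e.
rewrite freeze2.
- apply: eq_integral => om _; rewrite /Phi' patchE indicE.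
  case: ifPn => _; first by under eq_integral => w1 _ do under eq_integral => w2 _ do rewrite mul1e.
  by under eq_integral => w1 _ do under eq_integral => w2 _ do rewrite mul0e;
     rewrite !integral0_eq// => w1 _; rewrite integral0_eq.
- apply: emeasurable_funM => //; apply/measurable_EFinP.
  apply: (@measurableT_comp _ _ _ _ _ _ (\1_A : F -> R)).
    exact: (@measurable_indic _ F).
  exact: (measurableT_comp measurable_fst measurable_fst).
- by move=> om w1 w2; rewrite mule_ge0// lee_fin indicE.
Qed.

Lemma exp_dist_frozen (S : set 'rV[R]_d) (th : R) : S !=set0 ->
  (\int[P]_om (expR (th * dist_to S (x_ t.+1 om)))%:E =
   \int[P]_om \int[mu]_w1 \int[mu]_w2
     (expR (th * dist_to S (kw_next proj l nu (alpha t) (x_ t om) w1 w2)))%:E)%E /\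
  measurable_fun setT (fun om : T => \int[mu]_w1 \int[mu]_w2
     (expR (th * dist_to S (kw_next proj l nu (alpha t) (x_ t om) w1 w2)))%:E)%E.
Proof.
move=> S0.
pose Phi om w1 w2 : \bar R :=
  (expR (th * dist_to S (kw_next proj l nu (alpha t) (x_ t om) w1 w2)))%:E.
have Phi0 om w1 w2 : (0 <= Phi om w1 w2)%E by rewrite lee_fin expR_ge0.
have [mx m1 m2] := measurable_frozen.
have mPhi : measurable_fun setT (fun z : ((F * W) * W)%type => Phi z.1.1 z.1.2 z.2).
  exact: (measurable_exp_dist nu cX pX S0 ml th (alpha t) mx m1 m2).
split; first exact: (freeze2 mPhi Phi0).
have mPhi1 : measurable_fun setT (fun z : (F * W)%type => \int[mu]_w2 Phi z.1 z.2 w2)%E.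
  exact: (measurable_fun_fubini_tonelli_F (m2 := mu)
    (fun z : ((F * W) * W)%type => Phi z.1.1 z.1.2 z.2) mPhi (fun z => Phi0 _ _ _)).
have Phi10 om w1 : (0 <= \int[mu]_w2 Phi om w1 w2)%E by exact: integral_ge0.
have mG : measurable_fun setT (fun om : F => \int[mu]_w1 \int[mu]_w2 Phi om w1 w2)%E.
  exact: (measurable_fun_fubini_tonelli_F (m2 := mu)
    (fun z : (F * W)%type => \int[mu]_w2 Phi z.1 z.2 w2)%E mPhi1 (fun z => Phi10 _ _)).
move=> _ A mA; rewrite setTI; apply: (preimages_measurable measurable_wfam (s := past t)).
by have := mG measurableT A mA; rewrite setTI.
Qed.

End Frozen.

Lemma vmeasurable_iter t : vmeasurable (x_ t : T -> 'rV[R]_d).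
Proof.
move=> i _ A mA; rewrite setTI; apply: (preimages_measurable measurable_wfam (s := past t)).
by have := @vmeasurable_kw_iter (past t) t (fun _ h => h) i measurableT A mA; rewrite setTI.
Qed.

End Process.

(** * Step sizes *)

Section Window.
Variables (R : realType) (a u gamma : R).
Hypotheses (a0 : 0 < a) (u0 : 0 < u) (g01 : 0 <= gamma <= 1).

(** Each step size is [a * (u + i) ^ (1 - gamma) / (u + i)]; the power is at least its value at [u],
    and [1 / (u + i)] dominates a telescoping logarithm increment. *)
Lemma harmonic_sum_ge (s t : nat) : (s <= t)%N ->
  a * u `^ (1 - gamma) * ln ((u + t%:R) / (u + s%:R)) <=
    \sum_(s <= i < t) a / (u + i%:R) `^ gamma.
Proof.
move=> st; have ui i : 0 < u + i%:R :> R by rewrite ltr_pwDl.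
have -> : ln ((u + t%:R) / (u + s%:R)) =
    \sum_(s <= i < t) (ln (u + i.+1%:R) - ln (u + i%:R)).
  by rewrite (telescope_sumr (fun i => ln (u + i%:R)))// ln_div// ?posrE.
rewrite mulr_sumr; apply: ler_sum => i _.
have -> : a / (u + i%:R) `^ gamma = a * (u + i%:R) `^ (1 - gamma) * (u + i%:R)^-1.
  rewrite -mulrA; congr (_ * _).
  rewrite powRB; last by rewrite (gt_eqF (ui i)) implybT.
  rewrite powRr1; last exact: ltW.
  by rewrite mulrAC divff ?gt_eqF// mul1r.
apply: ler_pM.
- by rewrite mulr_ge0 ?powR_ge0// ltW.
- by rewrite subr_ge0 ler_ln ?posrE// lerD2l ler_nat.
- rewrite ler_pM2l//; apply: ge0_ler_powR; rewrite ?nnegrE ?(ltW u0) ?(ltW (ui i))//.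
  + by case/andP: g01 => _; rewrite subr_ge0.
  + by rewrite lerDl.
rewrite -ln_div ?posrE//.
have -> : (u + i.+1%:R) / (u + i%:R) = 1 + (u + i%:R)^-1.
  by rewrite -natr1; field; rewrite gt_eqF.
by apply: le_ln1Dx; rewrite (lt_trans (ltrN10 _))// invr_gt0.
Qed.

Variables (k Delta eta : R).
Hypotheses (k0 : 0 < k) (Delta0 : 0 <= Delta) (eta0 : 0 < eta).

(* Freezing the exponent at its final value [eps * (u + T)^gamma] on the window
   [T/q, T] keeps [theta * alpha_i] bounded, while [q] is large enough for the
   accumulated drift over the window to exceed the diameter [Delta]. *)
Lemma window : exists eps J : R, 0 < eps /\ forall T : nat, exists s : nat,
  let th := eps * (u + T%:R) `^ gamma in
  [/\ (s <= T.+1)%N,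
   forall i, (s <= i <= T)%N -> th * (a / (u + i%:R) `^ gamma) <= eta,
   forall i, (s <= i <= T)%N -> eps * a <= th * (a / (u + i%:R) `^ gamma) &
   th * (Delta - k * \sum_(s <= i < T.+1) a / (u + i%:R) `^ gamma) <= J].
Proof.
have /andP[g0 g1] := g01.
have ui i : 0 < u + i%:R :> R by rewrite ltr_pwDl.
pose a' := a * u `^ (1 - gamma).
have a'0 : 0 < a' by rewrite mulr_gt0// powR_gt0.
(* Chosen so that [a' * k * ln (q / 2) >= Delta]. *)
pose q := (Num.truncn (2 * expR (Delta / (a' * k)))).+1.
have q2 : expR (Delta / (a' * k)) <= q%:R / 2.
  by rewrite ler_pdivlMr// mulrC; apply/ltW/truncnS_gt.
have q0 : 0 < q%:R :> R by rewrite ltr0n.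
(* Bounds [(u + T) / (u + i)] on the window, since [T <= (s + 1) * q]. *)
pose Q : R := 1 + q%:R + q%:R / u.
have Q1 : 1 <= Q.
  by have : 0 <= q%:R / u by [rewrite divr_ge0// ltW]; rewrite /Q; lra.
have Q0 : 0 < Q by lra.
pose eps := eta / (a * Q).
have eps0 : 0 < eps by rewrite divr_gt0// mulr_gt0.
(* The bound [J] only serves the early times [T < u * q]; later the exponent is nonpositive. *)
exists eps, (eps * (1 + u + u * q%:R) * Delta); split => // T.
exists (T %/ q)%N; set s := (T %/ q)%N => th.
have sT : (s <= T)%N by exact: leq_div.
have sq : s%:R * q%:R <= T%:R :> R by rewrite -natrM ler_nat; exact: leq_trunc_div.
have Tsq : T%:R <= (s%:R + 1) * q%:R :> R.
  by rewrite natr1 -natrM ler_nat ltnW// ltn_ceil.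
have th0 : 0 <= th by rewrite mulr_ge0 ?powR_ge0// ltW.
split.
- exact: leqW.
- move=> i /andP[si iT]; rewrite mulrA ler_pdivrMr ?powR_gt0//.
  have -> : th * a = eta / Q * (u + T%:R) `^ gamma.
    by rewrite /th /eps; field; rewrite !gt_eqF.
  have TQ : u + T%:R <= Q * (u + i%:R).
    apply: (@le_trans _ _ (Q * (u + s%:R))); last by rewrite ler_pM2l// lerD2l ler_nat.
    have -> : Q * (u + s%:R) = u + q%:R * u + q%:R + s%:R * (1 + q%:R + q%:R / u).
      by rewrite /Q; field; rewrite gt_eqF.
    have h1 : 0 <= s%:R * (q%:R / u) by rewrite mulr_ge0// divr_ge0// ltW.
    have h2 : 0 <= q%:R * u by rewrite mulr_ge0// ltW.
    have h3 : 0 <= s%:R :> R by [].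
    by move: Tsq; rewrite !mulrDr !mulrDl; lra.
  rewrite -mulrA ler_pM2l// ler_pdivrMl//.
  apply: (@le_trans _ _ ((Q * (u + i%:R)) `^ gamma)).
    by apply: ge0_ler_powR; rewrite ?nnegrE// ?mulr_ge0 ?(ltW Q0) ?(ltW (ui _)).
  rewrite powRM ?(ltW Q0) ?(ltW (ui _))//; apply: ler_wpM2r; first exact: powR_ge0.
  by rewrite -[leRHS]powRr1 ?(ltW Q0)//; apply: ler_powR.
- move=> i /andP[si iT]; rewrite mulrA ler_pdivlMr ?powR_gt0// /th.
  rewrite [leRHS]mulrAC; apply: ler_wpM2l; first by rewrite mulr_ge0// ltW.
  by apply: ge0_ler_powR; rewrite ?nnegrE ?(ltW (ui _))// lerD2l ler_nat.
set S := \sum_(s <= i < T.+1) _.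
have S0 : 0 <= S by apply: sumr_ge0 => i _; rewrite divr_ge0 ?powR_ge0// ltW.
have [Tq|Tq] := leP (u * q%:R) T%:R.
  apply: (@le_trans _ _ 0).
    rewrite mulr_ge0_le0// subr_le0.
    have := harmonic_sum_ge (leqW sT); rewrite -/a' -/S => hS.
    (* Here [u] and [s] are both at most [T / q], so the ratio is at least [q / 2]. *)
    have hl : Delta / (a' * k) <= ln ((u + T.+1%:R) / (u + s%:R)).
      rewrite -[leLHS]expRK ler_ln ?posrE ?expR_gt0 ?divr_gt0//.
      apply: (le_trans q2); rewrite ler_pdivlMr//.
      have : T%:R <= T.+1%:R :> R by rewrite ler_nat.
      by move: Tq sq u0; lra.
    have : Delta <= a' * k * ln ((u + T.+1%:R) / (u + s%:R)).
      by rewrite [leRHS]mulrC -ler_pdivrMr// mulr_gt0.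
    have := ler_wpM2l (ltW k0) hS; lra.
  apply: mulr_ge0 => //; apply: mulr_ge0; first exact: ltW.
  by have := mulr_gt0 u0 q0; have := u0; lra.
apply: (@le_trans _ _ (th * Delta)).
  by apply: ler_wpM2l => //; rewrite gerBl mulr_ge0// ltW.
apply: ler_wpM2r => //; apply: ler_wpM2l; first exact: ltW.
have h1 : 1 <= 1 + u + u * q%:R by rewrite -addrA lerDl addr_ge0 ?mulr_ge0// ltW.
apply: (@le_trans _ _ ((1 + u + u * q%:R) `^ gamma)).
  apply: ge0_ler_powR; rewrite ?nnegrE ?(ltW (ui _)) ?(le_trans ler01 h1)//; lra.
by rewrite -[leRHS]powRr1 ?(le_trans ler01)//; apply: ler_powR.
Qed.

End Window.

(** The additive term is absorbed by [C], as [(1 - x) * C + N <= C] for [x = k * (th * al i)]; the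
    factors [1 - x <= expR (- x)] multiply to the exponential of the sum. *)
Lemma geometric_recursion (R : realType) (A : nat -> \bar R) (al : nat -> R)
    (th k Delta N C : R) (s t : nat) :
  0 <= C -> (s <= t)%N -> (A s <= (expR (th * Delta))%:E)%E ->
  (forall i, (s <= i < t)%N -> [/\ k * (th * al i) <= 1, N <= k * (th * al i) * C &
     (0 <= A i)%E /\ (A i.+1 <= (1 - k * (th * al i))%:E * A i + N%:E)%E]) ->
  (A t <= (expR (th * (Delta - k * \sum_(s <= i < t) al i)) + C)%:E)%E.
Proof.
move=> C0; elim: t => [|t ih].
  by rewrite leqn0 => /eqP -> h _; rewrite big_geq// mulr0 subr0 (le_trans h)// lee_fin lerDl.
rewrite leq_eqVlt => /predU1P[<- h _|st hs step].
  by rewrite big_geq// mulr0 subr0 (le_trans h)// lee_fin lerDl.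
rewrite ltnS in st.
have {}ih : (A t <= (expR (th * (Delta - k * \sum_(s <= i < t) al i)) + C)%:E)%E.
  by apply: ih => // i /andP[si it]; apply: step; rewrite si ltnW.
have [|k1 NC [A0 At]] := step t; first by rewrite st ltnSn.
apply: (le_trans At).
apply: (@le_trans _ _ ((1 - k * (th * al t))%:E *
  (expR (th * (Delta - k * \sum_(s <= i < t) al i)) + C)%:E + N%:E)%E).
  by rewrite leeD2r// lee_wpmul2l// lee_fin subr_ge0.
rewrite -EFinM -EFinD lee_fin big_nat_recr//=.
set Sm := \sum_(s <= i < t) al i.
have -> : th * (Delta - k * (Sm + al t)) = th * (Delta - k * Sm) + - (k * (th * al t)) by ring.
rewrite expRD; set E := expR (th * _).
have : (1 - k * (th * al t)) * E <= E * expR (- (k * (th * al t))).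
  by rewrite mulrC ler_wpM2l ?expR_ge0//; exact: expR_ge1Dx.
lra.
Qed.

(** * The feasible set and its minimisers *)

Section Feasible.
Variables (R : realType) (d : nat) (X : set 'rV[R]_d) (proj : 'rV[R]_d -> 'rV[R]_d).
Hypotheses (cX : convex_set X) (pX : is_proj X proj).
Hypotheses (X0 : X !=set0) (clX : closed X) (bX : bounded_set X).

Lemma diameter : exists2 Delta : R, 0 <= Delta &
  forall x z, X x -> X z -> enorm (x - z) <= Delta.
Proof.
have [M [_ hM]] := bX.
have hX x : X x -> `|x| <= `|M| + 1.
  by apply: hM; rewrite (le_lt_trans (ler_norm M))// ltrDl.
exists (d%:R * ((`|M| + 1) + (`|M| + 1))); first by rewrite mulr_ge0// addr_ge0.
move=> x z Xx Xz; apply: (le_trans (enorm_le_mx_norm _)); apply: ler_wpM2l => //.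
by apply: (le_trans (ler_normB _ _)); apply: lerD; exact: hX.
Qed.

(** Composition with the projection extends a function Lipschitz on [X] to a globally Lipschitz one,
    hence continuous and measurable. *)
Lemma lipschitz_proj (f : 'rV[R]_d -> R) (L : R) :
  (forall x y, X x -> X y -> `|f x - f y| <= L * enorm (x - y)) ->
  forall x y, `|f (proj x) - f (proj y)| <= `|L| * enorm (x - y).
Proof.
move=> fL x y; apply: (le_trans (fL _ _ (pX x).1 (pX y).1)).
have := proj_nonexpansive cX pX x y; have := ler_norm L; have := normr_ge0 L.
have := enorm_ge0 (proj x - proj y); nra.
Qed.

Lemma argmin_set_compact (f : 'rV[R]_d -> R) (L : R) :
  (forall x y, X x -> X y -> `|f x - f y| <= L * enorm (x - y)) ->
  argmin_set X f !=set0 /\ compact (argmin_set X f).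
Proof.
move=> fL; have cpX : compact X by exact: bounded_closed_compact.
have cf := lipschitz_continuous (lipschitz_proj fL).
have cfX : {within X, continuous (f \o proj)} by apply: continuous_subspaceT; exact: cf.
have [m /set_mem Xm mmin] := EVT_min_rV X0 cpX cfX.
have fm y : X y -> f m <= f y.
  by move=> Xy; have := mmin y (mem_set Xy); rewrite /= !(proj_id pX).
split; first by exists m.
(* The minimisers form a sublevel set of the continuous extension, hence a closed subset of [X]. *)
have -> : argmin_set X f = X `&` (f \o proj) @^-1` [set r | r <= f m].
  apply/seteqP; split => x /= [Xx]; rewrite (proj_id pX Xx).
    by move=> xmin; split => //; exact: xmin.
  by move=> xm; split => // y Xy; apply: le_trans xm (fm _ Xy).
apply: subclosed_compact cpX _; last exact: subIsetl.
apply: closedI => //; apply: preimage_closed; last exact: closed_le.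
by move=> x _; exact: cf.
Qed.

End Feasible.

(** * Uniform exponential moments of the rescaled distance *)

Section ExponentialBound.
Context (R : realType) (d : nat) (dT dW : measure_display) (T : measurableType dT)
  (W : measurableType dW) (P : probability T R) (mu : probability W R)
  (wp wm : nat -> T -> W) (X S : set 'rV[R]_d) (proj : 'rV[R]_d -> 'rV[R]_d)
  (x0 : 'rV[R]_d) (l : 'rV[R]_d -> W -> R) (a u gamma nu kappa lam M Delta : R).
Let alpha (t : nat) : R := a / (u + t%:R) `^ gamma.
Let x_ := kw_iter l nu alpha proj x0 wp wm.
Hypotheses (cX : convex_set X) (pX : is_proj X proj) (Xx0 : X x0).
Hypotheses (mwp : forall t, measurable_fun setT (wp t))
  (mwm : forall t, measurable_fun setT (wm t)).
Hypotheses (lwp : forall t B, measurable B -> P (wp t @^-1` B) = mu B)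
  (lwm : forall t B, measurable B -> P (wm t @^-1` B) = mu B).
Hypothesis ind : mutually_independent P (wfam wp wm).
Hypothesis ml : measurable_fun setT
  (fun p : (d.-tuple R * W)%type => l (\row_i tnth p.1 i) p.2).
Hypothesis il : forall x, mu.-integrable setT (fun w => (l x w)%:E).
Hypotheses (a0 : 0 < a) (u0 : 0 < u) (g01 : 0 <= gamma <= 1).
Hypotheses (kappa0 : 0 < kappa) (lam0 : 0 < lam) (M0 : 0 < M) (Delta0 : 0 <= Delta).
Hypotheses (S0 : S !=set0) (SX : S `<=` X).
Hypothesis XDelta : forall x, X x -> dist_to S x <= Delta.
Hypothesis drift : forall x, X x -> exists xs, [/\ S xs, enorm (x - xs) = dist_to S x &
     2 / 3 * kappa * enorm (x - xs) <= inner (mean_fdiff mu l nu x) (x - xs)].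
Hypothesis moment : forall t, cond_exp_le P (kw_filtration wp wm t)
  (fun om => expR (lam * enorm (kw_c l nu wp wm t (x_ t om) om))) M.

Lemma alpha_gt0 t : 0 < alpha t.
Proof. by rewrite divr_gt0// powR_gt0// ltr_pwDl. Qed.

Lemma measurable_dist_iter t : measurable_fun setT (fun om => dist_to S (x_ t om)).
Proof.
exact: (measurable_dist S0 (vmeasurable_iter x0 nu alpha cX pX mwp mwm ml t)).
Qed.

Lemma exp_dist_step (B eta th : R) (t : nat) : 0 < B ->
  M / (lam ^+ 2 * B) <= kappa / 6 -> eta <= lam / 2 ->
  eta * (8 * M / lam ^+ 2) <= kappa / 4 -> kappa / 4 * eta <= 1 ->
  0 <= th -> th * alpha t <= eta ->
  (\int[P]_om (expR (th * dist_to S (x_ t.+1 om)))%:E <=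
   (1 - kappa / 4 * (th * alpha t))%:E * \int[P]_om (expR (th * dist_to S (x_ t om)))%:E
     + (expR (eta * B) * M)%:E)%E.
Proof.
move=> B0 MB etalam etaM etakappa th0 tale.
have [-> mE] := exp_dist_frozen x0 nu alpha cX pX mwp mwm lwp lwm ind ml t th S0.
have c0 : 0 <= 1 - kappa / 4 * (th * alpha t).
  rewrite subr_ge0; apply: le_trans etakappa; apply: ler_wpM2l => //.
  exact/divr_ge0/ler0n/ltW.
have N0 : 0 <= expR (eta * B) * M by rewrite mulr_ge0 ?expR_ge0// ltW.
have mexp : measurable_fun setT (fun om => (expR (th * dist_to S (x_ t om)))%:E).
  apply/measurable_EFinP; apply: measurableT_comp => //.
  by apply: measurable_funM => //; exact: measurable_dist_iter.
have -> : ((1 - kappa / 4 * (th * alpha t))%:E * \int[P]_om (expR (th * dist_to S (x_ t om)))%:E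
     + (expR (eta * B) * M)%:E =
   \int[P]_om ((1 - kappa / 4 * (th * alpha t))%:E * (expR (th * dist_to S (x_ t om)))%:E
     + (expR (eta * B) * M)%:E))%E.
  rewrite ge0_integralD//; last 2 first.
  - by move=> om _; rewrite mule_ge0// lee_fin expR_ge0.
  - exact: measurable_funeM.
  rewrite ge0_integralZl//; congr (_ + _)%E; rewrite integral_cst//.
  by rewrite [X in (_ * X)%E]probability_setT mule1.
apply: ae_ge0_le_integral => //.
- move=> om _; apply: integral_ge0 => w1 _; apply: integral_ge0 => w2 _.
  by rewrite lee_fin expR_ge0.
- by move=> om _; rewrite -EFinM -EFinD lee_fin addr_ge0// mulr_ge0// expR_ge0.
- by apply: emeasurable_funD => //; exact: measurable_funeM.
have := exp_moment_frozen cX pX mwp mwm lwp lwm ind ml (ltW M0) (@moment t).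
apply: filterS => om GM _; rewrite -EFinM -EFinD.
apply: (mean_exp_step cX pX S0 SX ml il lam0 M0 B0 kappa0 MB etalam etaM etakappa) => //.
- exact: kw_iter_in.
- exact: alpha_gt0.
- by apply: drift; exact: kw_iter_in.
Qed.

Lemma exp_dist_bound : exists eps J : R, [/\ 0 < eps, 0 < J & forall t : nat,
  (\int[P]_om (expR (eps * (u + t%:R) `^ gamma * dist_to S (x_ t.+1 om)))%:E <= J%:E)%E].
Proof.
(* Makes [M / (lam ^+ 2 * B)] equal to [kappa / 6]. *)
pose B := 6 * M / (kappa * lam ^+ 2).
have l20 : 0 < lam ^+ 2 by rewrite exprn_gt0.
have B0 : 0 < B by rewrite divr_gt0 ?mulr_gt0.
have MB : M / (lam ^+ 2 * B) <= kappa / 6.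
  by rewrite le_eqVlt; apply/orP; left; apply/eqP; rewrite /B; field; rewrite !gt_eqF.
(* One term for each of the three smallness conditions that follow. *)
pose eta := Num.min (lam / 2) (Num.min (lam ^+ 2 * kappa / (32 * M)) (4 / kappa)).
have eta0 : 0 < eta by rewrite !lt_min !divr_gt0 ?mulr_gt0.
have etalam : eta <= lam / 2 by rewrite ge_min lexx.
have etaM : eta * (8 * M / lam ^+ 2) <= kappa / 4.
  rewrite -ler_pdivlMr ?divr_gt0 ?mulr_gt0//.
  have -> : kappa / 4 / (8 * M / lam ^+ 2) = lam ^+ 2 * kappa / (32 * M).
    by field; rewrite !gt_eqF.
  by rewrite /eta !ge_min lexx !orbT.
have etakappa : kappa / 4 * eta <= 1.
  rewrite -ler_pdivlMl ?divr_gt0//.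
  have -> : (kappa / 4)^-1 * 1 = 4 / kappa by field; rewrite !gt_eqF.
  by rewrite /eta !ge_min lexx !orbT.
have k40 : 0 < kappa / 4 by rewrite divr_gt0.
have [eps [J [eps0 hw]]] := window a0 u0 g01 k40 Delta0 eta0.
pose N := expR (eta * B) * M.
have N0 : 0 <= N by rewrite mulr_ge0 ?expR_ge0// ltW.
(* On the window [th * alpha i] is at least [eps * a], so this [C] satisfies the absorption
   condition of [geometric_recursion]. *)
pose C := N / (kappa / 4 * (eps * a)).
have kea : 0 < kappa / 4 * (eps * a) by rewrite !mulr_gt0.
have C0 : 0 <= C by rewrite divr_ge0// ltW.
exists eps, (expR J + C); split => //; first by rewrite ltr_pwDl// expR_gt0.
move=> t; have [s [st h1 h2 h3]] := hw t.
set th := eps * _ in h1 h2 h3 *.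
have th0 : 0 <= th by rewrite mulr_ge0 ?powR_ge0// ltW.
apply: (@le_trans _ _
  (expR (th * (Delta - kappa / 4 * \sum_(s <= i < t.+1) alpha i)) + C)%:E); last first.
  by rewrite lee_fin lerD2r ler_expR.
apply: (geometric_recursion (A := fun i => (\int[P]_om (expR (th * dist_to S (x_ i om)))%:E)%E)
  (N := N) C0 st).
  rewrite -[leRHS]mule1 -(probability_setT P) -integral_cst//; apply: ge0_le_integral => //.
    apply/measurable_EFinP; apply: measurableT_comp => //.
    by apply: measurable_funM => //; exact: measurable_dist_iter.
  by move=> om _; rewrite lee_fin ler_expR ler_wpM2l// XDelta//; exact: kw_iter_in.
move=> i; rewrite ltnS => si; split.
- by apply: le_trans etakappa; rewrite ler_wpM2l ?(ltW k40)//; exact: h1.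
- apply: (@le_trans _ _ (kappa / 4 * (eps * a) * C)).
    by rewrite /C mulrC divfK ?gt_eqF.
  by rewrite ler_wpM2r// ler_wpM2l ?(ltW k40)//; exact: h2.
split; first by apply: integral_ge0 => om _; rewrite lee_fin expR_ge0.
by apply: (exp_dist_step B0 MB etalam etaM etakappa th0); exact: h1.
Qed.

End ExponentialBound.

(** * Tail bound and bounds in mean *)

Unset Implicit Arguments.
Set Strict Implicit.
Set Printing Implicit Defensive.

Theorem theorem3
  (R : realType) (d : nat)
  (* sample space and noise space *)
  (dT dW : measure_display) (T : measurableType dT) (W : measurableType dW)
  (P : probability T R) (mu : probability W R) (* mu = law of \hat w *)
  (wp wm : nat -> T -> W)
  (* feasible set *)
  (X : set 'rV[R]_d) (proj : 'rV[R]_d -> 'rV[R]_d) (x0 : 'rV[R]_d)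
  (* objective *)
  (l : 'rV[R]_d -> W -> R) (grad : 'rV[R]_d -> 'rV[R]_d)
  (* parameters *)
  (a u gamma nu kappa c lambda M : R) :
  let lbar : 'rV[R]_d -> R := fun x => fine (\int[mu]_w (l x w)%:E)%E in
  let Xstar := argmin_set X lbar in
  let alpha : nat -> R := fun t => a / (u + t%:R) `^ gamma in
  let x_ := kw_iter l nu alpha proj x0 wp wm in
  let c_ := fun t om => kw_c l nu wp wm t (x_ t om) om in
  (* X nonempty, closed, bounded, convex; proj = Euclidean projection *)
  X !=set0 -> closed X -> bounded_set X -> convex_set X -> is_proj X proj ->
  X x0 ->
  (* noise: measurable, i.i.d. with law mu *)
  (forall t, measurable_fun setT (wp t)) -> (forall t, measurable_fun setT (wm t)) ->
  (forall t B, measurable B -> P (wp t @^-1` B) = mu B) ->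
  (forall t B, measurable B -> P (wm t @^-1` B) = mu B) ->
  mutually_independent P (wfam wp wm) ->
  (* l jointly (Borel x W) measurable; l(x) = E[l(x, w)] well defined *)
  measurable_fun setT (fun p : (d.-tuple R * W)%type => l (\row_i tnth p.1 i) p.2) ->
  (forall x, mu.-integrable setT (fun w => (l x w)%:E)) ->
  (* bounded variance on X *)
  (exists V : R, forall x, X x ->
      (\int[mu]_w (((l x w - lbar x) ^+ 2)%:E) <= V%:E)%E) ->
  (* l Lipschitz on X *)
  (exists Lip : R, forall x y, X x -> X y ->
      `|lbar x - lbar y| <= Lip * enorm (x - y)) ->
  (* step sizes *)
  0 < a -> 0 < u -> 0 <= gamma <= 1 -> 0 < nu ->
  (* (D1) *)
  0 < kappa ->
  (forall x xs, X x -> Xstar xs -> enorm (x - xs) = dist_to Xstar x ->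
      inner (grad x) (x - xs) >= kappa * enorm (x - xs)) ->
  (* (D2) *)
  0 < lambda ->
  (forall t, cond_exp_le P (kw_filtration wp wm t)
                (fun om => expR (lambda * enorm (c_ t om))) M) ->
  (* (D3) *)
  0 < c ->
  (forall x, X x ->
      enorm (grad x - (2 * nu)^-1 *: \row_(i < d) (lbar (x + nu *: unitv i)
                                               - lbar (x - nu *: unitv i)))
      <= c * nu ^+ 2) ->
  nu <= Num.sqrt (kappa / (3 * c)) ->
  exists (J I K L : R), 0 < J /\ 0 < I /\ 0 < K /\ 0 < L /\
    (forall (t : nat) (z : R), 0 <= z ->
       (P [set om | (dist_to Xstar (x_ t.+1 om) >= z)%R]
          <= (J * expR (- (I * (t%:R `^ gamma) * z)))%:E)%E) /\
    (forall t : nat, (1 <= t)%N ->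
       (\int[P]_om (dist_to Xstar (x_ t.+1 om))%:E
          <= (K / t%:R `^ gamma)%:E)%E /\
       (\int[P]_om (lbar (x_ t.+1 om) - inf [set lbar y | y in X])%:E
          <= (L / t%:R `^ gamma)%:E)%E).
Proof.
move=> lbar Xstar alpha x_ c_ X0 clX bX cX pX Xx0 mwp mwm lwp lwm ind ml il _ [Lip lipX]
  a0 u0 g01 nu0 kappa0 D1 lam0 D2 c0 D3 nule.
have [S0 cS] := argmin_set_compact cX pX X0 clX bX lipX.
rewrite -/Xstar in S0 cS.
have SX : Xstar `<=` X by move=> ? [].
have [Delta Delta0 hD] := diameter bX.
have XDelta x : X x -> dist_to Xstar x <= Delta.
  by move=> Xx; have [z Sz <-] := dist_to_attained x S0 cS; apply: hD => //; exact: SX.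
(* The condition on [nu] limits the bias of the difference quotient to [kappa / 3], which leaves a
   drift of [2 / 3 * kappa] from (D1). *)
have cnu : c * nu ^+ 2 <= kappa / 3.
  have kc0 : 0 <= kappa / (3 * c) by rewrite divr_ge0 ?mulr_ge0// ltW.
  have -> : kappa / 3 = c * (kappa / (3 * c)) by field; rewrite gt_eqF.
  apply: (ler_wpM2l (ltW c0)).
  by rewrite -[leRHS](sqr_sqrtr kc0) ler_pXn2r ?nnegrE ?sqrtr_ge0// ltW.
have drift x : X x -> exists xs, [/\ Xstar xs, enorm (x - xs) = dist_to Xstar x &
     2 / 3 * kappa * enorm (x - xs) <= inner (mean_fdiff mu l nu x) (x - xs)].
  move=> Xx; have [xs Sxs xsx] := dist_to_attained x S0 cS; exists xs; split => //.
  have d1 := D1 _ _ Xx Sxs xsx; have := D3 _ Xx; rewrite -/(mean_fdiff mu l nu x) => d3.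
  have := cauchy_schwarz (grad x - mean_fdiff mu l nu x) (x - xs).
  rewrite innerBl ler_norml => /andP[_ cs].
  have := ler_wpM2r (enorm_ge0 (x - xs)) (le_trans d3 cnu); lra.
(* Enlarging [M] ensures positivity and keeps (D2). *)
pose M' := Num.max M 1.
have M'0 : 0 < M' by rewrite lt_max ltr01 orbT.
have moment t : cond_exp_le P (kw_filtration wp wm t)
    (fun om => expR (lambda * enorm (kw_c l nu wp wm t (x_ t om) om))) M'.
  move=> A FA; apply: (le_trans (D2 t A FA)); apply: lee_wpmul2r => //.
  by rewrite lee_fin le_max lexx.
have [eps [J [eps0 J0 hJ]]] := exp_dist_bound cX pX Xx0 mwp mwm lwp lwm ind ml il a0 u0 g01
  kappa0 lam0 M'0 Delta0 S0 SX XDelta drift moment.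
have mD t : measurable_fun setT (fun om => dist_to Xstar (x_ t om)).
  exact: (measurable_dist S0 (vmeasurable_iter x0 nu alpha cX pX mwp mwm ml t)).
have D0 x : 0 <= dist_to Xstar x by exact: dist_to_ge0.
have mexp (th : R) t : measurable_fun setT (fun om => (expR (th * dist_to Xstar (x_ t om)))%:E).
  apply/measurable_EFinP; apply: measurableT_comp => //; exact: measurable_funM.
have exp0 (th : R) t om : (0 <= (expR (th * dist_to Xstar (x_ t om)))%:E)%E.
  by rewrite lee_fin expR_ge0.
have th_ge t : eps * t%:R `^ gamma <= eps * (u + t%:R) `^ gamma.
  have /andP[g0 _] := g01; rewrite ler_pM2l//.
  by apply: ge0_ler_powR; rewrite ?nnegrE ?lerDr ?addr_ge0// ltW.
(* Serves both means, with [r = 1] and [r = |Lip| + 1], through [x <= expR x]; [1 <= t] makes the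
   division by the power of [t] legitimate. *)
have lin_bound (t : nat) (r : R) (f : T -> R) : (1 <= t)%N -> 0 <= r ->
    measurable_fun setT f -> (forall om, 0 <= f om <= r * dist_to Xstar (x_ t.+1 om)) ->
    (\int[P]_om (f om)%:E <= (r * (J / eps) / t%:R `^ gamma)%:E)%E.
  move=> t1 r0 mf fr; set th := eps * (u + t%:R) `^ gamma.
  have tg : 0 < t%:R `^ gamma :> R by rewrite powR_gt0// ltr0n.
  pose k := r / (eps * t%:R `^ gamma).
  have k0 : 0 <= k by rewrite divr_ge0// mulr_ge0// ltW.
  have -> : r * (J / eps) / t%:R `^ gamma = k * J by rewrite /k; field; rewrite !gt_eqF.
  apply: (@le_trans _ _ (\int[P]_om (k%:E * (expR (th * dist_to Xstar (x_ t.+1 om)))%:E))%E).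
    apply: ge0_le_integral => //.
    - by move=> om _; rewrite lee_fin; case/andP: (fr om).
    - exact/measurable_EFinP.
    - exact: measurable_funeM.
    move=> om _; rewrite -EFinM lee_fin; have /andP[_ /le_trans] := fr om; apply.
    rewrite /k -mulrA; apply: ler_wpM2l => //.
    rewrite ler_pdivlMl ?mulr_gt0//.
    apply: (le_trans (ler_wpM2r (D0 _) (th_ge t))).
    have := expR_ge1Dx (th * dist_to Xstar (x_ t.+1 om)); rewrite -/th; lra.
  rewrite ge0_integralZl// (EFinM k J); apply: lee_wpmul2l => //; exact: hJ.
exists J, eps, (J / eps), ((`|Lip| + 1) * (J / eps)).
have K0 : 0 < J / eps by rewrite divr_gt0.
do 3 (split=> //); split; first by rewrite mulr_gt0// ltr_wpDl.
split.
  move=> t z z0; set A := [set om | _].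
  have mA : measurable A.
    have := mD t.+1 measurableT _ (measurable_itv `[z, +oo[).
    rewrite setTI; congr measurable.
    by apply/seteqP; split => om /=; rewrite in_itv/= andbT.
  set th := eps * (u + t%:R) `^ gamma.
  (* Markov's inequality for the exponential. *)
  have PA : ((expR (th * z))%:E * P A <= J%:E)%E.
    rewrite -integral_cst//; apply: le_trans (hJ t).
    apply: (@le_trans _ _ (\int[P]_(om in A) (expR (th * dist_to Xstar (x_ t.+1 om)))%:E)%E).
      apply: ge0_le_integral => //.
      - by move=> om _; rewrite lee_fin expR_ge0.
      - by apply: measurable_funS (mexp th t.+1).
      move=> om Aom; rewrite lee_fin ler_expR ler_wpM2l//.
      by rewrite mulr_ge0 ?powR_ge0// ltW.
    by apply: ge0_subset_integral => //; exact: mexp.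
  have PAf := fineK (fin_num_measure P _ mA).
  rewrite -PAf -EFinM lee_fin -ler_pdivlMl ?expR_gt0// -expRN in PA.
  rewrite -PAf lee_fin; apply: (le_trans PA); rewrite mulrC ler_pM2l// ler_expR lerN2.
  exact: ler_wpM2r (th_ge t).
move=> t t1; split.
  rewrite -[J / eps]mul1r; apply: lin_bound => // om.
  by rewrite mul1r lexx D0.
have [xm Sxm] := S0.
have infE : inf [set lbar y | y in X] = lbar xm.
  apply/eqP; rewrite eq_le; apply/andP; split.
    apply: ge_inf; last by exists xm => //; exact: SX.
    by exists (lbar xm) => _ [y Xy <-]; exact: Sxm.2.
  apply: lb_le_inf; first by exists (lbar xm), xm => //; exact: SX.
  by move=> _ [y Xy <-]; exact: Sxm.2.
have Xx om : X (x_ t.+1 om) by exact: (kw_iter_in wp wm l nu alpha pX Xx0).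
rewrite infE; apply: lin_bound => //.
  apply: measurable_funB => //.
  (* The iterates lie in [X], so [lbar] may be replaced by its Lipschitz extension to obtain
     measurability. *)
  have -> : (fun om => lbar (x_ t.+1 om)) = (fun om => lbar (proj (x_ t.+1 om))).
    by apply/funext => om; rewrite (proj_id pX).
  apply: (measurable_lipschitz (phi := lbar \o proj) (normr_ge0 Lip) (lipschitz_proj cX pX lipX)).
  exact: (vmeasurable_iter x0 nu alpha cX pX mwp mwm ml t.+1).
move=> om; rewrite subr_ge0 Sxm.2//=.
have [xs Sxs <-] := dist_to_attained (x_ t.+1 om) S0 cS.
(* All minimisers share one value, so the nearest one can replace [xm] before the Lipschitz bound is
   used. *)
have -> : lbar xm = lbar xs.
  by apply/eqP; rewrite eq_le (Sxm.2 _ (SX _ Sxs)) (Sxs.2 _ (SX _ Sxm)).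
apply: (le_trans (ler_norm _)); apply: (le_trans (lipX _ _ (Xx om) (SX _ Sxs))).
apply: ler_wpM2r; first exact: enorm_ge0.
by apply: (le_trans (ler_norm _)); rewrite lerDl.
Qed.
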